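(* Let $T$ be a geometric, weakly locally modular complete theory in a language $\mathcal{L}$, $\mathcal{M}=(M,\dots)\models T$, $r\ge2$, and let $\varphi(\bar x_1,\dots,\bar x_r,\bar y)$ be an $\mathcal{L}$-formula without parameters with $|\bar x_i|=d_i$, $|\bar y|=e$. Then there is $\alpha=\alpha(\varphi)>0$ such that for every $b\in M^e$, letting $E_b=\{(a_1,\dots,a_r)\in M^{d_1}\times\dots\times M^{d_r}:\mathcal{M}\models\varphi(a_1,\dots,a_r,b)\}$, exactly one of the following holds: \begin{enumerate} \item $E_b$ is not $K_{k,\dots,k}$-free for any $k\in\mathbb{N}$; \item for every finite $r$-grid $B\subseteq\prod_{i\in[r]}M^{d_i}$, $|E_b\cap B|\le\alpha\,\delta^r_{r-1}(B)$. \end{enumerate}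
   Context: $\operatorname{acl}(A)$: a tuple lies in $\operatorname{acl}(A)$ if it lies in a finite $A$-definable set. $T$ is geometric if in every model acl satisfies exchange for singletons ($b\in\operatorname{acl}(A,a)\setminus\operatorname{acl}(A)\Rightarrow a\in\operatorname{acl}(A,b)$) and $T$ eliminates $\exists^\infty$ (for each $\varphi(x,y)$, $x$ a single variable, there is $k$ such that $\varphi(x,b)$ having more than $k$ solutions implies infinitely many). $\dim(a/A)$ is the least length of a subtuple $a'$ of $a$ with $\operatorname{acl}(aA)=\operatorname{acl}(a'A)$; $A\mathop{\perp}_C B$ means $\dim(a/BC)=\dim(a/C)$ for all finite tuples $a$ from $A$. $T$ is weakly locally modular if for every saturated model and small $A,B$ there is small $C$ with $C\mathop{\perp}_\emptyset AB$ and $A\mathop{\perp}_{\operatorname{acl}(AC)\cap\operatorname{acl}(BC)}B$. An $r$-grid is $B_1\times\dots\times B_r$ with $B_i\subseteq M^{d_i}$; $E_b$ is $K_{k,\dots,k}$-free if it contains no $C_1\times\dots\times C_r$ with $|C_i|=k$. For finite $B$ with $n_i=|B_i|$, $\delta^r_{r-1}(B)=\sum_{i_1<\dots<i_{r-1}}n_{i_1}\cdots n_{i_{r-1}}$. *)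

(* Defs.v *)
From HB Require Import structures.
From mathcomp Require Import all_boot all_order all_algebra.
From mathcomp Require Import boolp classical_sets functions cardinality reals.

Set Implicit Arguments.
Unset Strict Implicit.
Unset Printing Implicit Defensive.

Local Open Scope classical_set_scope.
Local Open Scope card_scope.

(** * First-order logic *)

Record language := Language {
  fsym : Type;
  far : fsym -> nat;
  rsym : Type;
  rar : rsym -> nat }.

Inductive term (L : language) (V : Type) : Type :=
| TVar of V
| TApp (f : fsym L) of ('I_(far f) -> term L V).

(* The free variables are indexed by [V]; the variable bound by [FAll] is
   [None : option V]. *)
Inductive formula (L : language) (V : Type) : Type :=
| FBot
| FEq of term L V & term L V
| FRel (R : rsym L) of ('I_(rar R) -> term L V)
| FImp of formula L V & formula L V
| FAll of formula L (option V).

Arguments FBot {L V}.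

Definition FNot (L : language) (V : Type) (phi : formula L V) : formula L V :=
  FImp phi FBot.

Record structure (L : language) := Structure {
  carrier :> Type;
  fint : forall f : fsym L, ('I_(far f) -> carrier) -> carrier;
  rint : forall R : rsym L, ('I_(rar R) -> carrier) -> Prop;
  carrier_inhabited : inhabited carrier }.

Fixpoint teval (L : language) (M : structure L) (V : Type) (t : term L V)
    (v : V -> M) : M :=
  match t with
  | TVar x => v x
  | TApp f ts => fint (fun i => teval (ts i) v)
  end.

Fixpoint sat (L : language) (M : structure L) (V : Type) (phi : formula L V) :
    (V -> M) -> Prop :=
  match phi with
  | FBot => fun _ => False
  | FEq t u => fun v => teval t v = teval u v
  | FRel R ts => fun v => rint (fun i => teval (ts i) v)
  | FImp phi psi => fun v => sat phi v -> sat psi v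
  | FAll phi => fun v => forall x : M, sat phi (oapp v x)
  end.

Definition sentence (L : language) := formula L void.

Definition models (L : language) (M : structure L) (T : set (sentence L)) :=
  forall sigma, T sigma -> sat sigma (of_void M).

Definition entails (L : language) (T : set (sentence L)) (sigma : sentence L) :=
  forall M : structure L, models M T -> sat sigma (of_void M).

Definition complete_theory (L : language) (T : set (sentence L)) :=
  (exists M : structure L, models M T) /\
  forall sigma, entails T sigma \/ entails T (FNot sigma).

(* Elements of [M^n] are functions ['I_n -> M]. *)
Definition join (X Y M : Type) (x : X -> M) (y : Y -> M) (v : X + Y) : M :=
  match v with inl i => x i | inr j => y j end.

(** * Algebraic closure, dimension, independence *)

Section Geometry.
Variables (L : language) (M : structure L).

Definition definable_over (A : set M) (n : nat) (X : set ('I_n -> M)) :=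
  exists phi : formula L ('I_n + {c : M | A c}),
    X = [set x | sat phi (join x sval)].

Definition tuple_in_acl (A : set M) (n : nat) (a : 'I_n -> M) :=
  exists X : set ('I_n -> M), [/\ definable_over A X, finite_set X & X a].

Definition acl (A : set M) : set M :=
  [set x | tuple_in_acl A (fun _ : 'I_1 => x)].

Definition acl_exchange := forall (A : set M) (a b : M),
  acl (A `|` [set a]) b -> ~ acl A b -> acl (A `|` [set b]) a.

(* The subtuple of [a] with index set [S] has length [#|S|]. *)
Definition acl_dim (n : nat) (a : 'I_n -> M) (A : set M) : nat :=
  #|[arg min_(S < [set: 'I_n]%SET
       | `[< acl (range a `|` A) = acl (a @` [set` S] `|` A) >]) #|S|]|.

Definition indep (A C B : set M) :=
  forall (n : nat) (a : 'I_n -> M), (forall i, A (a i)) ->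
    acl_dim a (B `|` C) = acl_dim a C.

(** * Saturation *)

(* A cardinal is represented by a type of that cardinality. *)
Definition small (kappa : Type) (A : set M) := ~ ([set: kappa] #<= A).

Definition saturated (kappa : Type) :=
  forall A : set M, small kappa A ->
  forall p : set (formula L (option {c : M | A c})),
    (forall q, finite_set q -> q `<=` p ->
       exists x : M, forall psi, q psi -> sat psi (oapp sval x)) ->
    exists x : M, forall psi, p psi -> sat psi (oapp sval x).

End Geometry.

(** * Geometric and weakly locally modular theories *)

Definition eliminates_exists_infty (L : language) (T : set (sentence L)) :=
  forall (m : nat) (phi : formula L (option 'I_m)),
  exists k : nat, forall M : structure L, models M T ->
  forall b : 'I_m -> M, let X := [set x : M | sat phi (oapp b x)] in
    `I_k.+1 #<= X -> infinite_set X.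

Definition geometric (L : language) (T : set (sentence L)) :=
  (forall M : structure L, models M T -> acl_exchange M) /\
  eliminates_exists_infty T.

(* "Saturated" and "small" are understood in the monster-model sense:
   [kappa]-saturated, resp. of cardinality less than [kappa], for a cardinal
   [kappa > |L| + aleph_0]. *)
Definition weakly_locally_modular (L : language) (T : set (sentence L)) :=
  forall kappa : Type, ~ ([set: kappa] #<= [set: fsym L + rsym L + nat]) ->
  forall M : structure L, models M T -> saturated M kappa ->
  forall A B : set M, small kappa A -> small kappa B ->
  exists C : set M,
    [/\ small kappa C,
        indep C set0 (A `|` B)
      & indep A (acl (A `|` C) `&` acl (B `|` C)) B].

(** * Grids *)

Section Grids.
Variables (M : Type) (r : nat) (d : 'I_r -> nat).

Definition point := forall i : 'I_r, 'I_(d i) -> M.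

Definition grid (B : forall i : 'I_r, set ('I_(d i) -> M)) : set point :=
  [set a | forall i, B i (a i)].

Definition K_free (k : nat) (E : set point) :=
  ~ exists C : forall i : 'I_r, set ('I_(d i) -> M),
      (forall i, C i #= `I_k) /\ grid C `<=` E.

End Grids.

(* The choices [i_1 < ... < i_(r-1)] are the subsets of ['I_r] of size [r - 1]. *)
Definition delta (r : nat) (n : 'I_r -> nat) : nat :=
  (\sum_(S : {set 'I_r} | #|S| == r.-1) \prod_(i in S) n i)%N.

Definition fiber (L : language) (M : structure L) (r : nat) (d : 'I_r -> nat)
    (e : nat) (phi : formula L ({i : 'I_r & 'I_(d i)} + 'I_e))
    (b : 'I_e -> M) : set (point M d) :=
  [set a : point M d | sat phi (join (fun ij => a (tag ij) (tagged ij)) b)].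

Definition exactly_one (P Q : Prop) := (P /\ ~ Q) \/ (~ P /\ Q).

(* Main.v *)
Require Import Defs.
From mathcomp Require Import all_boot all_order all_algebra.
From mathcomp Require Import boolp classical_sets functions cardinality reals filter.

(** Let [E^(0) = E_b], and let [E^(l+1)] be the set of the points [a] of [E^(l)] such
    that, for every [i], the fiber of [E^(l)] through [a] in the direction [i] is
    infinite. Elimination of [exists^infty] makes these sets definable uniformly in the
    model and in [b], with a bound [K_l] on the finite projections of the fibers to
    single coordinates. Let [n] be the number of coordinates. If [E^(n+1)] is empty, every
    edge lies in some [E^(l) \ E^(l+1)] with [l <= n], hence in a finite fiber of bounded
    size, and counting gives the linear bound with a constant that only depends on the
    [K_l].

    Otherwise go to a saturated model. From a point of [E^(n+1)] one reaches, replacing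
    one block of coordinates at a time and increasing its dimension each time, a point [a]
    of [E_b] with [a_i] not in [acl(a_j (j <> i), b)] for all [i]. Weak local modularity
    then multiplies the blocks one after the other into [k] tuples: it makes the block [v]
    at hand independent from the other ones over a finite set [D'] such that [v] is not
    algebraic over [D'] and these other blocks, and [v] can be replaced by generic
    realizations of its type over them. This yields a grid [K_{k,...,k}] inside [E_b], and
    the existence of such a grid is a first-order property, so it holds in the original
    model.

    A saturated model is built by adjoining a formal realization of every type in [kappa]
    variables over every [kappa]-sequence of names, and by choosing with Zorn's lemma an
    ultrafilter on the assignments of the names in [M] for which these realizations are
    correct. *)

Set Implicit Arguments.
Unset Strict Implicit.
Unset Printing Implicit Defensive.

Local Open Scope classical_set_scope.
Local Open Scope card_scope.

(** * Cardinals and finite sets *)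

Lemma card_le_sigP (T U : Type) (A : set T) (B : set U) :
  A #<= B <-> exists f : {x | A x} -> {y | B y}, injective f.
Proof.
pose toS V (D : set V) (x : {x | D x}) : set_type D :=
  exist _ (sval x) (mem_set (svalP x)).
pose ofS V (D : set V) (x : set_type D) : {x | D x} :=
  exist _ (sval x) (set_mem (svalP x)).
have toS_inj V (D : set V) : injective (@toS V D).
  by move=> [x Dx] [y Dy] /(congr1 sval) /= xy; exact: eq_exist.
have ofS_inj V (D : set V) : injective (@ofS V D).
  by move=> [x Dx] [y Dy] /(congr1 sval) /= xy; exact: eq_exist.
split=> [/card_leP[f]|[f injf]].
- exists (@ofS _ B \o f \o @toS _ A) => x y /= /ofS_inj fxy.
  by apply/toS_inj/(@inj _ _ _ f); rewrite ?in_setT.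
- apply/card_leP/injfunPex; exists (@toS _ B \o f \o @ofS _ A) => //.
  by move=> x y _ _ /= /toS_inj /injf /ofS_inj.
Qed.

Lemma card_le_injT (T U : Type) (f : T -> U) (B : set U) :
  injective f -> (forall x, B (f x)) -> [set: T] #<= B.
Proof.
move=> injf Bf; apply/card_le_sigP.
exists (fun x => exist _ (f (sval x)) (Bf (sval x))).
by move=> [x ?] [y ?] /(congr1 sval) /= /injf xy; apply: eq_exist.
Qed.

Lemma card_leT_inj (T U : Type) (B : set U) :
  [set: T] #<= B -> exists2 f : T -> U, injective f & forall x, B (f x).
Proof.
move=> /card_le_sigP[f injf]; exists (fun x => sval (f (exist _ x I))).
  move=> x y fxy.
  have /injf/(congr1 sval) // : f (exist _ x I) = f (exist _ y I).
  by move: fxy; case: (f _) => u Bu; case: (f _) => w Bw /= uw; exact: eq_exist.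
by move=> x; apply: svalP.
Qed.

Lemma finite_set_elim (T : Type) (P : set T -> Prop) :
  P set0 -> (forall x A, finite_set A -> P A -> P (x |` A)) ->
  forall A, finite_set A -> P A.
Proof.
elim/Peq: T P => T P P0 PU A /finite_seqP[s ->]; elim: s => [|x s IH].
  by rewrite (_ : [set` [::]] = set0) //; apply/seteqP; split.
rewrite (_ : [set` x :: s] = x |` [set` s]); first exact/PU.
apply/seteqP; split=> y /=; rewrite inE.
  by case/orP=> [/eqP->|]; [left|right].
by case=> [->|->]; rewrite ?eqxx ?orbT.
Qed.

Lemma finite_rangeP (T : Type) (A : set T) :
  finite_set A <-> exists n (f : 'I_n -> T), A = range f.
Proof.
split=> [|[n [f ->]]]; last exact/finite_image/finite_finset.
move: A; apply: finite_set_elim.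
  by exists 0%N, (fun i : 'I_0 => match notF (ltn_ord i) with end); apply/seteqP; split=> // x [[]].
move=> x A _ [n [f ->]]; exists n.+1, (fun i => oapp f x (unlift ord0 i)).
apply/seteqP; split=> y.
  case=> [->|[i _ <-]]; first by exists ord0 => //; rewrite unlift_none.
  by exists (lift ord0 i) => //; rewrite liftK.
by case=> i _ <-; case: unliftP => [j _|_] /=; [right; exists j|left].
Qed.

Lemma finite_bigcup_fin (I : finType) (T : Type) (F : I -> set T) :
  (forall i, finite_set (F i)) -> finite_set (\bigcup_i F i).
Proof. by move=> Ff; apply: bigcup_finite => //; exact: finite_finset. Qed.

Lemma finite_range (I : finType) (T : Type) (f : I -> T) : finite_set (range f).
Proof. exact/finite_image/finite_finset. Qed.

(** * Formulas *)

Section Formulas.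
Variable L : language.

Fixpoint trename (V W : Type) (h : V -> W) (t : term L V) : term L W :=
  match t with
  | TVar x => TVar L (h x)
  | TApp f ts => TApp (fun i => trename h (ts i))
  end.

Fixpoint frename (V W : Type) (h : V -> W) (phi : formula L V) : formula L W :=
  match phi with
  | FBot => FBot
  | FEq t u => FEq (trename h t) (trename h u)
  | FRel R ts => FRel (fun i => trename h (ts i))
  | FImp phi psi => FImp (frename h phi) (frename h psi)
  | FAll phi => FAll (frename (omap h) phi)
  end.

Lemma teval_trename (M : structure L) (V W : Type) (h : V -> W) (t : term L V)
    (v : W -> M) : teval (trename h t) v = teval t (v \o h).
Proof. by elim: t => //= f ts IH; congr fint; apply/funext. Qed.

Lemma oapp_omap (V W M : Type) (h : V -> W) (v : W -> M) (x : M) :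
  oapp v x \o omap h = oapp (v \o h) x.
Proof. by apply/funext => -[]. Qed.

Lemma sat_frename (M : structure L) (V W : Type) (h : V -> W) (phi : formula L V)
    (v : W -> M) : sat (frename h phi) v <-> sat phi (v \o h).
Proof.
elim: phi W h v => {V} [V|V t u|V R ts|V phi IHphi psi IHpsi|V phi IH] W h v /=.
- by [].
- by rewrite !teval_trename.
- by under [X in rint X]funext do rewrite teval_trename.
- by rewrite IHphi IHpsi.
- by split=> satphi x; have := satphi x; rewrite IH oapp_omap.
Qed.

Lemma term_support (V : Type) (t : term L V) : exists2 s : set V, finite_set s &
  forall (M : structure L) (v w : V -> M), (forall x, s x -> v x = w x) ->
    teval t v = teval t w.
Proof.
elim: t => [x|f ts IH].
  by exists [set x] => //= M v w -> //.
pose s i := sval (cid2 (IH i)).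
have sP i : finite_set (s i) /\ forall (M : structure L) (v w : V -> M),
    (forall x, s i x -> v x = w x) -> teval (ts i) v = teval (ts i) w.
  by rewrite /s; case: cid2.
exists (\bigcup_i s i); first by apply: finite_bigcup_fin => i; have [] := sP i.
move=> M v w vw /=; congr fint; apply/funext => i; apply: (sP i).2 => x sx.
by apply: vw; exists i.
Qed.

(** Arities are finite, so a formula mentions finitely many variables even when [V] is infinite. One
    implication suffices, because the hypothesis on [v] and [w] is symmetric. *)
Lemma sat_support (V : Type) (phi : formula L V) : exists2 s : set V, finite_set s &
  forall (M : structure L) (v w : V -> M), (forall x, s x -> v x = w x) ->
    sat phi v -> sat phi w.
Proof.
elim: phi => {V} [V|V t u|V R ts|V phi [s fs IHs] psi [s' fs' IHs']|V phi [s fs IH]].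
- by exists set0.
- have [s fs sP] := term_support t; have [s' fs' sP'] := term_support u.
  exists (s `|` s'); first by rewrite finite_setU.
  move=> M v w vw /=; rewrite (sP _ v w) => [|x sx]; last by apply: vw; left.
  by rewrite (sP' _ v w) // => x sx; apply: vw; right.
- have tsP i := term_support (ts i).
  pose s i := sval (cid2 (tsP i)).
  have sP i : finite_set (s i) /\ forall (M : structure L) (v w : V -> M),
      (forall x, s i x -> v x = w x) -> teval (ts i) v = teval (ts i) w.
    by rewrite /s; case: cid2.
  exists (\bigcup_i s i); first by apply: finite_bigcup_fin => i; have [] := sP i.
  move=> M v w vw /=; under [X in rint X -> _]funext => i.
    rewrite ((sP i).2 _ v w) => [|x sx]; last by apply: vw; exists i.
    over.
  by [].
- exists (s `|` s'); first by rewrite finite_setU.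
  move=> M v w vw /= vimp wphi; apply: (IHs' _ v w) => [x sx|].
    by apply: vw; right.
  by apply/vimp/(IHs _ w v) => // x sx; rewrite vw //; left.
- exists (some @^-1` s); first by apply: finite_preimage fs => x y _ _ [].
  move=> M v w vw /= vphi x; apply: IH (vphi x) => -[y|] //= sy.
  exact: vw.
Qed.

End Formulas.

(** * Uniform definability *)

Lemma card_ge_ordP (T : Type) (A : set T) (k : nat) :
  `I_k #<= A <-> exists2 u : 'I_k -> T, injective u & forall j, A (u j).
Proof.
split=> [kA|[u injf Au]].
  apply: card_leT_inj; apply: card_le_trans kA.
  by have /card_eqPle[] := @card_II k.
apply: card_le_trans (card_le_injT injf Au).
by have /card_eqPle[] := @card_II k.
Qed.

Section Definability.
Variable L : language.

(** One formula has to define the predicate in all structures. The closure lemmas below replace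
    explicit syntax, and renamings of variables become compositions of assignments. *)
Definition definable (V : Type) (P : forall M : structure L, (V -> M) -> Prop) :=
  exists phi : formula L V, forall (M : structure L) (v : V -> M), P M v <-> sat phi v.

Lemma definable_ext (V : Type) (P Q : forall M : structure L, (V -> M) -> Prop) :
  (forall M v, P M v <-> Q M v) -> definable P -> definable Q.
Proof. by move=> PQ [phi phiP]; exists phi => M v; rewrite -PQ. Qed.

Lemma definable_sat (V : Type) (phi : formula L V) :
  definable (fun M v => sat phi v).
Proof. by exists phi. Qed.

Lemma definable_comp (V W : Type) (h : V -> W)
    (P : forall M : structure L, (V -> M) -> Prop) :
  definable P -> definable (fun M w => P M (w \o h)).
Proof. by move=> [phi phiP]; exists (frename h phi) => M w; rewrite sat_frename. Qed.

Lemma definable_eq (V : Type) (x y : V) :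
  definable (fun (M : structure L) v => v x = v y).
Proof. by exists (FEq (TVar L x) (TVar L y)). Qed.

Lemma definable_imp (V : Type) (P Q : forall M : structure L, (V -> M) -> Prop) :
  definable P -> definable Q -> definable (fun M v => P M v -> Q M v).
Proof.
move=> [phi phiP] [psi psiP]; exists (FImp phi psi) => M v /=.
by rewrite phiP psiP.
Qed.

Lemma definable_not (V : Type) (P : forall M : structure L, (V -> M) -> Prop) :
  definable P -> definable (fun M v => ~ P M v).
Proof. by move=> /definable_imp; apply; exists FBot. Qed.

Lemma definable_and (V : Type) (P Q : forall M : structure L, (V -> M) -> Prop) :
  definable P -> definable Q -> definable (fun M v => P M v /\ Q M v).
Proof.
move=> dP dQ; have := definable_not (definable_imp dP (definable_not dQ)).
apply: definable_ext => M v; split=> [|[p q]]; last exact.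
by move=> npq; split; apply: contrapT => n; apply: npq.
Qed.

Lemma definable_all (V : Type) (P : forall M : structure L, (option V -> M) -> Prop) :
  definable P -> definable (fun M v => forall x : M, P M (oapp v x)).
Proof.
move=> [phi phiP]; exists (FAll phi) => M v /=.
by split=> pv x; apply/phiP.
Qed.

Lemma definable_ex (V : Type) (P : forall M : structure L, (option V -> M) -> Prop) :
  definable P -> definable (fun M v => exists x : M, P M (oapp v x)).
Proof.
move=> dP; have := definable_not (definable_all (definable_not dP)).
apply: definable_ext => M v; split=> [|[x px]]; last by move/(_ x).
by move=> npq; apply: contrapT => n; apply: npq => x px; apply: n; exists x.
Qed.

Lemma definable_forall_fin (V : Type) (I : finType)
    (P : I -> forall M : structure L, (V -> M) -> Prop) :
  (forall i, definable (P i)) -> definable (fun M v => forall i, P i M v).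
Proof.
move=> dP.
suff [phi phiP] : definable (fun M v => forall i, i \in enum I -> P i M v).
  by exists phi => M v; rewrite -phiP; split=> Pv i //; apply: Pv; rewrite mem_enum.
elim: (enum I) => [|i s IH]; first by exists (FImp FBot FBot) => M v; split=> [_ []|_ i].
apply: definable_ext (definable_and (dP i) IH) => M v; split.
  by move=> [Pi Ps] j; rewrite in_cons => /predU1P[->|/Ps].
by move=> Ps; split=> [|j js]; apply: Ps; rewrite in_cons ?eqxx ?js ?orbT.
Qed.

Lemma definable_exists_fin (V : Type) (I : finType)
    (P : I -> forall M : structure L, (V -> M) -> Prop) :
  (forall i, definable (P i)) -> definable (fun M v => exists i, P i M v).
Proof.
move=> dP.
have := definable_not (definable_forall_fin (fun i => definable_not (dP i))).
apply: definable_ext => M v; split=> [|[x px]]; last by move/(_ x).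
by move=> npq; apply: contrapT => n; apply: npq => x px; apply: n; exists x.
Qed.

Lemma definable_ex_tuple (U : finType) (W : Type)
    (P : forall M : structure L, (U + W -> M) -> Prop) :
  definable P -> definable (fun M w => exists u : U -> M, P M (join u w)).
Proof.
have ordE n : forall (W : Type) (P : forall M : structure L, ('I_n + W -> M) -> Prop),
    definable P -> definable (fun M w => exists u : 'I_n -> M, P M (join u w)).
  elim: n => {W P} [|n IH] W P dP.
    pose h (v : 'I_0 + W) : W := match v with
      inl i => match notF (ltn_ord i) with end | inr w => w end.
    apply: definable_ext (definable_comp h dP) => M w.
    have hE u : w \o h = join u w by apply/funext => -[[]|].
    split=> [Pw|[u]]; last by rewrite -hE.
    by exists (w \o h \o inl); rewrite -hE.
  pose h (v : 'I_n.+1 + W) : 'I_n + option W := match v with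
    inl i => if unlift ord0 i is Some j then inl j else inr None
  | inr w => inr (Some w) end.
  have := definable_ex (IH _ _ (definable_comp h dP)).
  apply: definable_ext => M w; split=> [[x [u Pu]]|[u Pu]].
    exists (fun i => oapp u x (unlift ord0 i)); congr (P M _): Pu.
    by apply/funext => -[i|y] //=; case: unliftP.
  exists (u ord0), (fun i => u (lift ord0 i)); congr (P M _): Pu.
  by apply/funext => -[i|y] //=; case: unliftP => [j|] ->.
move=> dP.
pose h (v : U + W) : 'I_#|U| + W := match v with
  inl i => inl (enum_rank i) | inr w => inr w end.
have := ordE _ _ _ (definable_comp h dP).
apply: definable_ext => M w; split=> [] [u Pu].
  exists (u \o enum_rank); congr (P M _): Pu.
  by apply/funext => -[].
exists (u \o enum_val); congr (P M _): Pu.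
by apply/funext => -[i|] //=; rewrite enum_rankK.
Qed.

Lemma definable_card_ge (V : Type) (k : nat)
    (P : forall M : structure L, (option V -> M) -> Prop) :
  definable P -> definable (fun M v => `I_k #<= [set x | P M (oapp v x)]).
Proof.
move=> dP.
pose h j (x : option V) : 'I_k + V := if x is Some y then inr y else inl j.
have dinj (i j : 'I_k) : definable (fun M (v : 'I_k + V -> M) =>
    v (inl i) = v (inl j) -> i = j).
  apply: definable_imp; first exact: definable_eq.
  (* A condition on indices alone is a constant, expressed by [FBot] or [FImp FBot FBot]. *)
  have [ij|ij] := pselect (i = j); last by exists FBot.
  by exists (FImp FBot FBot) => M v; split=> // _ [].
have := definable_ex_tuple (definable_and
  (definable_forall_fin (fun i => definable_forall_fin (dinj i)))
  (definable_forall_fin (fun j => definable_comp (h j) dP))).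
apply: definable_ext => M v; rewrite card_ge_ordP.
have hE u j : join u v \o h j = oapp v (u j) by apply/funext => -[].
split=> [[u [iu uP]]|[u iu uP]].
  by exists u => [i j|j]; [exact: iu|rewrite /= -hE; exact: uP].
by exists u; split=> [i j|j]; [exact: iu|rewrite hE; exact: uP].
Qed.

End Definability.

Lemma finite_conjunction (L : language) (V : Type) (q : set (formula L V)) :
  finite_set q -> definable (fun (M : structure L) (v : V -> M) =>
    forall psi, q psi -> sat psi v).
Proof.
move: q; apply: finite_set_elim => [|psi q _ IH].
  by exists (FImp FBot FBot) => M v; split=> // _ [].
apply: definable_ext (definable_and (definable_sat psi) IH) => M v.
split=> [[vpsi vq] chi [->|/vq]|vq] //.
by split=> [|chi qchi]; apply: vq; [left|right].
Qed.

(** * Ultrafilters on finitely supported sets of assignments *)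

Section Names.
Variables (L : language) (M : structure L) (K : Type) (k0 : K).

(** In the formulas of [p], the variable [Some k] stands for the name [f k] and [None] for the
    witness. As the parameters are names again, one inductive type takes the place of a transfinite
    chain of extensions. The set [p] may be inconsistent: the ultrafilter decides whether it has to
    be realized. *)
Inductive name :=
| BaseName
| Witness (f : K -> name) (p : set (formula L (option K))).

(* Only finitely supported sets are measured by the filters below, so that unions
   of chains of such filters still decide every set. *)
Definition supported (D : set name) (X : set (name -> M)) :=
  exists2 s : set name, finite_set s & s `<=` D /\
    forall g g', (forall c, s c -> g c = g' c) -> X g -> X g'.

Definition satisfiable_set (f : K -> name) (q : set (formula L (option K))) :
    set (name -> M) :=
  [set g : name -> M | exists x, forall psi, q psi -> sat psi (oapp (g \o f) x)].

Lemma supported_sub (D D' : set name) (X : set (name -> M)) :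
  D `<=` D' -> supported D X -> supported D' X.
Proof.
by move=> DD' [s fs [sD sX]]; exists s => //; split=> //; apply: subset_trans DD'.
Qed.

Lemma supported_setC (D : set name) (X : set (name -> M)) :
  supported D X -> supported D (~` X).
Proof.
move=> [s fs [sD sX]]; exists s => //; split=> // g g' gg' nXg Xg'.
by apply: nXg; apply: sX Xg' => c /gg'.
Qed.

Lemma supported_setI (D : set name) (X Y : set (name -> M)) :
  supported D X -> supported D Y -> supported D (X `&` Y).
Proof.
move=> [s fs [sD sX]] [t ft [tD tY]]; exists (s `|` t); first by rewrite finite_setU.
split=> [c [/sD|/tD] //|g g' gg' [Xg Yg]].
by split; [apply: sX Xg => c sc|apply: tY Yg => c tc]; apply: gg'; [left|right].
Qed.

Lemma supported_sat (V : Type) (psi : formula L V) (v : V -> name) :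
  supported (range v) [set g : name -> M | sat psi (g \o v)].
Proof.
have [s fs sP] := sat_support psi; exists (v @` s); first exact: finite_image.
split=> [_ [x _ <-]|g g' gg']; first by exists x.
by apply: sP => x sx; apply: gg'; exists x.
Qed.

Lemma supported_satisfiable (f : K -> name) (q : set (formula L (option K))) :
  finite_set q -> supported (range f) (satisfiable_set f q).
Proof.
move=> /finite_conjunction/definable_ex[phi phiP].
rewrite (_ : satisfiable_set f q = [set g : name -> M | sat phi (g \o f)]).
  exact: supported_sat.
by apply/seteqP; split=> g /phiP.
Qed.

(** An ultrafilter on the sets supported by [D], for which the witnesses in [D] realize their types
    whenever these are finitely satisfiable almost everywhere. The premise [D c] of [good_decides]
    makes the empty pair good, as the empty chain in Zorn's lemma requires. *)
Record good (D : set name) (F : set (set (name -> M))) : Prop := Good {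
  good_closed : forall f p, D (Witness f p) -> forall k, D (f k);
  good_supported : forall X, F X -> supported D X;
  good_decides : forall c X, D c -> supported D X -> F X \/ F (~` X);
  good_setI : forall X Y, F X -> F Y -> F (X `&` Y);
  good_set0 : ~ F set0;
  good_real : forall f p, D (Witness f p) ->
    (forall q, finite_set q -> q `<=` p -> F (satisfiable_set f q)) ->
    forall psi, p psi -> F [set g : name -> M | sat psi (g \o oapp f (Witness f p))] }.

Lemma good_neq0 D F X : good D F -> F X -> X !=set0.
Proof.
move=> gF FX; apply: contrapT => X0; apply: (good_set0 gF).
by rewrite -(_ : X = set0) //; apply/seteqP; split=> // g Xg; apply: X0; exists g.
Qed.

Lemma good_ultra D F c X (gF : good D F) : D c -> supported D X ->
  (~ F (~` X)) -> F X.
Proof. by move=> Dc sX; case: (good_decides gF Dc sX). Qed.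

Lemma good_not D F X : good D F -> F X -> ~ F (~` X).
Proof.
move=> gF FX FnX; apply: (good_set0 gF).
by rewrite -(setICr X); exact: (good_setI gF).
Qed.

(** Sets of [F] do not depend on the value at the new name [c], so an assignment that makes a finite
    part of [p] satisfiable can be changed at [c] to realize it. This gives the finite intersection
    property; an ultrafilter is then restricted to the sets supported by [D] and [c]. *)
Lemma ultra_extension D F (f : K -> name) p c : good D F -> ~ D c ->
  p = set0 \/ ((forall k, D (f k)) /\
    forall q, finite_set q -> q `<=` p -> F (satisfiable_set f q)) ->
  exists2 F', F `<=` F' & [/\ (forall X, F' X -> supported (c |` D) X),
    (forall X, supported (c |` D) X -> F' X \/ F' (~` X)),
    (forall X Y, F' X -> F' Y -> F' (X `&` Y)), ~ F' set0 &
    forall psi, p psi -> F' [set g : name -> M | sat psi (g \o oapp f c)]].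
Proof.
move=> gF nDc pP.
pose realized q : set (name -> M) :=
  [set g : name -> M | forall psi, q psi -> sat psi (g \o oapp f c)].
(* [setT] is allowed beside the sets of [F], because [F] may be empty when [D] is. *)
have FIP X q : F X \/ X = setT -> finite_set q -> q `<=` p -> X `&` realized q !=set0.
  move=> FX fq qp.
  have [g [Xg gq]] : exists g, X g /\ (q = set0 \/
       (forall k, D (f k)) /\ satisfiable_set f q g).
    case: pP => [p0|[fD /(_ q fq qp) Fq]].
      have q0 : q = set0 by apply/seteqP; split=> // psi /qp; rewrite p0.
      case: FX => [/(good_neq0 gF)[g Xg]|->]; first by exists g; split=> //; left.
      by have [x] := carrier_inhabited M; exists (fun=> x); split=> //; left.
    case: FX => [FX|->].
      have [g [Xg qg]] := good_neq0 gF (good_setI gF FX Fq).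
      by exists g; split=> //; right.
    by have [g qg] := good_neq0 gF Fq; exists g; split=> //; right.
  case: gq => [q0|[fD [x xq]]].
    by exists g; split=> // psi; rewrite q0.
  pose g' d := if pselect (d = c) is left _ then x else g d.
  have gg' d : D d -> g d = g' d.
    by move=> Dd; rewrite /g'; case: pselect => // dc; rewrite dc in Dd.
  exists g'; split.
    case: FX => [/(good_supported gF)[s _ [sD sX]]|-> //].
    by apply: sX Xg => d /sD; exact: gg'.
  move=> psi /xq; rewrite (_ : g' \o oapp f c = oapp (g \o f) x) //.
  apply/funext => -[k|] /=; first by rewrite -gg'.
  by rewrite /g'; case: pselect.
pose F0 : set_system (name -> M) := [set Y | exists X q, [/\ F X \/ X = setT,
  finite_set q, q `<=` p & X `&` realized q `<=` Y]].
have FF0 : ProperFilter F0.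
  split.
    by move=> [X [q [FX fq qp XY]]]; have [g /XY] := FIP X q FX fq qp.
  split.
  - by exists setT, set0; split=> //; right.
  - move=> Y Y' [X [q [FX fq qp XY]]] [X' [q' [FX' fq' qp' XY']]].
    exists (X `&` X'), (q `|` q'); split.
    + case: FX FX' => [FX|->] [FX'|->]; rewrite ?setTI ?setIT; [|by left|by left|by right].
      by left; exact: (good_setI gF).
    + by rewrite finite_setU.
    + by move=> psi [/qp|/qp'].
    + move=> g [[Xg Xg'] gq]; split.
        by apply: XY; split=> // psi qpsi; apply: gq; left.
      by apply: XY'; split=> // psi qpsi; apply: gq; right.
  - move=> Y Y' YY' [X [q [FX fq qp XY]]]; exists X, q; split=> //.
    exact: subset_trans YY'.
have [U [ultraU F0U]] := ultraFilterLemma FF0.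
have FU X : F X -> U X.
  move=> FX; apply: F0U; exists X, set0.
  by split=> //; left.
exists [set X | U X /\ supported (c |` D) X].
  move=> X FX; split; first exact: FU.
  by apply: supported_sub (good_supported gF FX) => d; right.
split.
- by move=> X [].
- move=> X sX; case: (in_ultra_setVsetC X ultraU) => UX; [left|right]; split=> //.
  exact: supported_setC.
- by move=> X Y [UX sX] [UY sY]; split; [exact: filterI|exact: supported_setI].
- by move=> [/filter_not_empty].
- move=> psi ppsi; split.
    apply: F0U; exists setT, [set psi]; split=> //; first by right.
    + by move=> _ ->.
    + by move=> g [_ /(_ psi erefl)].
  have [p0|[fD _]] := pP; first by rewrite p0 in ppsi.
  apply: supported_sub (supported_sat _ _) => d [[k|] _ <-]; [by right; exact: fD|by left].
Qed.

Lemma good_extension D F c : good D F -> ~ D c ->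
  (forall f p, c = Witness f p -> forall k, D (f k)) ->
  exists F', F `<=` F' /\ good (c |` D) F'.
Proof.
move=> gF nDc cD.
pose fc := if c is Witness f _ then f else fun=> BaseName.
pose pc := if c is Witness _ p then p else set0.
(* The new witness has to realize its type only if [F] makes the type finitely satisfiable;
   otherwise [p] is empty. *)
pose p := [set psi | pc psi /\ 
  (forall q, finite_set q -> q `<=` pc -> F (satisfiable_set fc q))].
have [|F' FF' [F's F'd F'I F'0 F'p]] := @ultra_extension D F fc p c gF nDc.
  have [pT|npT] := pselect (forall q, finite_set q -> q `<=` pc ->
    F (satisfiable_set fc q)); last by left; apply/seteqP; split=> // psi [].
  have [->|/set0P[psi [ppsi _]]] := eqVneq p set0; first by left.
  right; split=> [k|q fq qp]; last by apply: pT => // chi /qp[].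
  by rewrite /fc /pc in ppsi *; case: (c) cD ppsi => // f q /(_ f q erefl).
exists F'; split=> //; split=> //.
- move=> f q [/esym/cD fD|/(good_closed gF) fD] k; right; exact: fD.
- by move=> d X _; exact: F'd.
- have old f q d : finite_set q -> (forall k, D (f k)) -> D d ->
      F' (satisfiable_set f q) -> F (satisfiable_set f q).
    move=> fq fD Dd F'q; apply: (good_ultra gF Dd).
      by apply: supported_sub (supported_satisfiable f fq) => _ [k _ <-].
    move=> /FF' F'nq; apply: F'0; rewrite -(setICr (satisfiable_set f q)).
    exact: F'I.
  move=> f q [cE|Dq] sq psi qpsi.
    have fD := cD _ _ (esym cE).
    move: F'p; rewrite /p /pc /fc -cE; apply; split=> // q' fq' q'q.
    by apply: (old _ _ (f k0)) => //; exact: sq.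
  apply/FF'/(good_real gF Dq _ qpsi) => q' fq' q'q.
  by apply: (old _ _ _ _ _ Dq) => //; [exact: good_closed gF _ _ Dq|exact: sq].
Qed.
(** A domain and its filter are encoded as one subset of a sum type, so that Zorn's lemma for unions
    applies. A finite support lies in the domain of one member of the chain, which decides the
    set. *)
Lemma good_chain (A : set (set (name + set (name -> M)))) :
  (forall G, A G -> good (inl @^-1` G) (inr @^-1` G)) -> total_on A subset ->
  good (inl @^-1` \bigcup_(G in A) G) (inr @^-1` \bigcup_(G in A) G).
Proof.
move=> Agood Atot.
have step (x y : name + set (name -> M)) : (\bigcup_(G in A) G) x ->
    (\bigcup_(G in A) G) y -> exists2 G, A G & G x /\ G y.
  move=> [G AG Gx] [G' AG' G'y]; have [GG'|G'G] := Atot _ _ AG AG'.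
    by exists G' => //; split=> //; exact: GG'.
  by exists G => //; split=> //; exact: G'G.
have sub (s : set name) c : finite_set s -> s `<=` inl @^-1` (\bigcup_(G in A) G) ->
    (\bigcup_(G in A) G) (inl c) -> exists2 G, A G & G (inl c) /\ s `<=` inl @^-1` G.
  move=> + + Uc; move: s; apply: finite_set_elim.
    by move=> _; have [G AG [Gc _]] := step _ _ Uc Uc; exists G => //; split=> // ? [].
  move=> x s _ IH xsU.
  have [|G AG [Gc sG]] := IH; first by move=> y sy; apply: xsU; right.
  have [G' AG' [G'c G'x]] := step _ _ Uc (xsU x (or_introl erefl)).
  have [GG'|G'G] := Atot _ _ AG AG'.
    exists G' => //; split=> // y [->//|/sG]; exact: GG'.
  exists G => //; split=> // y [->|/sG //]; exact: G'G.
split.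
- move=> f p [G AG Gf] k; exists G => //; exact: good_closed (Agood G AG) _ _ Gf k.
- move=> X [G AG GX]; apply: supported_sub (good_supported (Agood G AG) GX).
  by move=> d Gd; exists G.
- move=> c X Dc [s fs [sD sX]]; have [G AG [Gc sG]] := sub s c fs sD Dc.
  have sXG : supported (inl @^-1` G) X by exists s.
  by have [] := good_decides (Agood G AG) Gc sXG; [left|right]; exists G.
- move=> X Y FX FY; have [G AG [GX GY]] := step _ _ FX FY.
  by exists G => //; exact: good_setI (Agood G AG) _ _ GX GY.
- by move=> [G AG]; exact: good_set0 (Agood G AG).
- move=> f p [G AG Gf] sp psi ppsi; exists G => //.
  apply: (good_real (Agood G AG) Gf) ppsi => q fq qp.
  have sq : supported (inl @^-1` G) (satisfiable_set f q).
    apply: supported_sub (supported_satisfiable f fq) => _ [k _ <-].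
    exact: good_closed (Agood G AG) _ _ Gf k.
  have [//|Gnq] := good_decides (Agood G AG) Gf sq.
  have [G' AG' [/= G'q G'nq]] := step (inr _) (inr _) (sp q fq qp) (ex_intro2 _ _ G AG Gnq).
  by have := good_not (Agood G' AG') G'q.
Qed.

(** By induction on names, the domain of a maximal good pair contains every name: once the
    parameters are there, adjoining the name would give a larger good pair. *)
Lemma exists_good : exists F, good [set: name] F.
Proof.
pose P := [set G : set (name + set (name -> M)) | good (inl @^-1` G) (inr @^-1` G)].
have [G [Ggood Gmax]] : exists G, P G /\ forall G', G `<` G' -> ~ P G'.
  by apply: Zorn_bigcup => A AP Atot; apply: good_chain.
suff DT c : G (inl c).
  exists (inr @^-1` G); rewrite (_ : [set: name] = inl @^-1` G) //.
  by apply/seteqP; split=> // c _; exact: DT.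
elim: c => [|f IH p]; apply: contrapT => nDc.
- have [|F' [FF' F'good]] := good_extension Ggood nDc; first by [].
  pose G' := [set x | match x with inl d => (BaseName |` inl @^-1` G) d | inr X => F' X end].
  apply: (Gmax G') => //; split; first by case=> [d Gd|X /FF' //]; right.
  by move=> /(_ (inl BaseName)) G'G; apply/nDc/G'G; left.
- have [|F' [FF' F'good]] := good_extension Ggood nDc; first by move=> f' p' [<- _].
  pose G' := [set x | match x with inl d => (Witness f p |` inl @^-1` G) d | inr X => F' X end].
  apply: (Gmax G') => //; split; first by case=> [d Gd|X /FF' //]; right.
  by move=> /(_ (inl (Witness f p))) G'G; apply/nDc/G'G; left.
Qed.

End Names.
Arguments Witness {L K} f p.

(** * Saturated models *)

(** A maximal partial injection from [A] to [U] is total on [A] or onto [U], and the second case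
    would embed [U] into [A]. This serves to index small sets of parameters by [K]. *)
Lemma card_le_total (T U : Type) (A : set T) :
  ~ ([set: U] #<= A) -> exists f : {x | A x} -> U, injective f.
Proof.
move=> UA.
pose P := [set G : set (T * U) | (forall x y, G (x, y) -> A x) /\
  forall x y x' y', G (x, y) -> G (x', y') -> (x = x' <-> y = y')].
have [G [[GA Ginj] Gmax]] : exists G, P G /\ forall G', G `<` G' -> ~ P G'.
  apply: Zorn_bigcup => F FP Ftot; split.
    by move=> x y [X FX Xxy]; exact: (FP X FX).1 Xxy.
  move=> x y x' y' [X FX Xxy] [Y FY Yxy].
  have [XY|YX] := Ftot _ _ FX FY.
    by apply: (FP Y FY).2 => //; apply: XY.
  by apply: (FP X FX).2 => //; apply: YX.
have [domG|/existsNP[x0 /not_implyP[Ax0 nGx0]]] :=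
    pselect (forall x, A x -> exists y, G (x, y)).
  pose f (x : {x | A x}) := projT1 (cid (domG (sval x) (svalP x))).
  have fG x : G (sval x, f x) by rewrite /f; case: cid.
  exists f => -[x Ax] [y Ay] fxy; apply: eq_exist.
  by apply/(Ginj _ _ _ _ (fG (exist _ x Ax)) (fG (exist _ y Ay))).
have [ranG|/existsNP[y0 nGy0]] := pselect (forall y, exists x, G (x, y)).
  exfalso; apply: UA; pose f y := projT1 (cid (ranG y)).
  have fG y : G (f y, y) by rewrite /f; case: cid.
  apply: (@card_le_injT _ _ f) => [y y' fyy'|y].
    by apply/(Ginj _ _ _ _ (fG y) (fG y')).
  exact: GA (fG y).
exfalso; apply: (Gmax ((x0, y0) |` G)).
  split; first by move=> z; right.
  by move=> /(_ (x0, y0) (or_introl erefl)) Gxy; apply: nGx0; exists y0.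
split; first by move=> x y [[-> _] //|/GA].
move=> x y x' y' [[-> ->]|Gxy] [[-> ->]|Gxy'] //.
- split=> [xx'|yy']; first by case: nGx0; exists y'; rewrite xx'.
  by case: nGy0; exists x'; rewrite yy'.
- split=> [xx'|yy']; first by case: nGx0; exists y; rewrite -xx'.
  by case: nGy0; exists x; rewrite -yy'.
- exact: Ginj.
Qed.

Lemma Cantor (X : Type) (h : set X -> X) : ~ injective h.
Proof.
move=> injh; pose D := [set x | exists2 S, h S = x & ~ S x].
have [Dh|nDh] := pselect (D (h D)); last by apply: (nDh); exists D.
by have [S /injh SD nS] := Dh; apply: nS; rewrite SD.
Qed.

Section CanonicalModel.
Variables (L : language) (M : structure L) (K : Type) (code : nat -> K).
Hypothesis code_inj : injective code.
Notation name := (name L K).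
Variable F : set (set (name -> M)).
Hypothesis F_good : good [set: name] F.

Lemma measured_mono (X Z : set (name -> M)) :
  F X -> X `<=` Z -> supported setT Z -> F Z.
Proof.
move=> FX XZ sZ; apply: (good_ultra (c := BaseName L K) F_good I sZ) => FnZ.
have [g [Xg nZg]] := good_neq0 F_good (good_setI F_good FX FnZ).
exact/nZg/XZ.
Qed.

Lemma measured_sat (V : Type) (psi : formula L V) (v : V -> name) :
  supported setT [set g : name -> M | sat psi (g \o v)].
Proof. by apply: supported_sub (@supported_sat _ M _ _ psi v). Qed.

Lemma measured_eq (c d : name) : supported setT [set g : name -> M | g c = g d].
Proof.
have := @measured_sat _ (FEq (TVar L true) (TVar L false)) (fun b => if b then c else d).
by [].
Qed.

Lemma measured_setT : F setT.
Proof.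
have [|//|] := good_decides F_good (c := BaseName L K) I (X := setT).
  by exists set0.
by rewrite setCT => /(good_set0 F_good).
Qed.

Lemma measured_all (X : set (name -> M)) : (forall g, X g) -> F X.
Proof.
move=> XT; rewrite (_ : X = setT); first exact: measured_setT.
by apply/seteqP; split.
Qed.

Lemma measured_finite (V : Type) (s : set V) (P : V -> set (name -> M)) :
  finite_set s -> (forall x, s x -> F (P x)) -> F [set g : name -> M | forall x, s x -> P x g].
Proof.
move: s; apply: finite_set_elim => [_|x s fs IH sP].
  by apply: measured_all => g x [].
have := good_setI F_good (sP x (or_introl erefl)) (IH (fun y sy => sP y (or_intror sy))) => Fx.
congr (F _): Fx; apply/seteqP; split=> [g [Px Ps] y [->|/Ps]|g sPg] //.
by split=> [|y sy]; apply: sPg; [left|right].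
Qed.

Definition eqname (c d : name) := F [set g : name -> M | g c = g d].

Lemma eqname_refl c : eqname c c.
Proof. exact: measured_all. Qed.

Lemma eqname_sym c d : eqname c d -> eqname d c.
Proof. by rewrite /eqname => cd; congr (F _): cd; apply/seteqP; split. Qed.

Lemma eqname_trans c d e : eqname c d -> eqname d e -> eqname c e.
Proof.
move=> cd de; apply: measured_mono (good_setI F_good cd de) _ (measured_eq _ _).
by move=> g [/= -> ->].
Qed.

(** Chosen representatives replace the quotient of the names by almost everywhere equality; the
    elements of the model are the names that represent themselves. *)
Definition repr (c : name) : name :=
  xget (BaseName L K : {classic name}) [set d | eqname c d].

Lemma eqname_repr c : eqname c (repr c).
Proof. by apply: (@xgetPex {classic name}); exists c; exact: eqname_refl. Qed.

Lemma repr_eq c d : repr c = repr d <-> eqname c d.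
Proof.
split=> [cd|cd].
  apply: eqname_trans (eqname_repr c) _; rewrite cd.
  exact/eqname_sym/eqname_repr.
rewrite /repr (_ : [set e | eqname c e] = [set e | eqname d e]) //.
apply/seteqP; split=> e /= ce.
  by apply: eqname_trans ce; exact: eqname_sym.
exact: eqname_trans ce.
Qed.

Definition element := {c : name | repr c = c}.

Definition class (c : name) : element :=
  exist _ (repr c) (esym (proj2 (repr_eq _ _) (eqname_repr c))).

Lemma class_eq c d : class c = class d <-> eqname c d.
Proof.
split=> [/(congr1 sval)/repr_eq //|/repr_eq cd]; exact: eq_exist.
Qed.

Lemma class_sval (x : element) : class (sval x) = x.
Proof. by case: x => c cP; apply: eq_exist. Qed.

Lemma eqname_class c : eqname (sval (class c)) c.
Proof. exact/eqname_sym/eqname_repr. Qed.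

(** Witnesses take parameters indexed by [K], so other families of names are first reindexed along
    an injection into [K]. *)
Lemma recode (V : Type) (s : set V) (h : V -> K) (v : V -> name) :
  (forall x y, s x -> s y -> h x = h y -> x = y) ->
  exists f : K -> name, forall x, s x -> f (h x) = v x.
Proof.
move=> injh.
pose f k := if pselect (exists2 x, s x & h x = k) is left e
  then v (projT1 (cid2 e)) else BaseName L K.
exists f => x sx; rewrite /f; case: pselect => [e|[]]; last by exists x.
by case: cid2 => y sy hyx /=; congr v; exact: injh.
Qed.

(** The finitely many variables that matter in [psi] are coded in [K] through [code]; the witness of
    the recoded formula, taken as a type with one element, is the name sought. *)
Lemma henkin (V : Type) (psi : formula L (option V)) (v : V -> name) :
  F [set g : name -> M | exists x, sat psi (oapp (g \o v) x)] ->
  exists c, F [set g : name -> M | sat psi (g \o oapp v c)].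
Proof.
move=> Fex; have [s fs sP] := sat_support psi.
have [n [u uE]] : exists n (u : 'I_n -> V), some @^-1` s = range u.
  by apply/finite_rangeP; apply: finite_preimage fs => x y _ _ [].
pose idx x : nat := if pselect (exists i, u i = x) is left e
  then projT1 (cid e) else 0%N.
have idxP x : s (some x) -> exists2 i : 'I_n, idx x = i & u i = x.
  move=> sx; have [i _ ui] : range u x by rewrite -uE.
  rewrite /idx; case: pselect => [e|[]]; last by exists i.
  by case: cid => k uk; exists k.
pose h := code \o idx.
have [f fE] : exists f : K -> name, forall x, s (some x) -> f (h x) = v x.
  apply: (@recode _ (some @^-1` s)) => x y sx sy /code_inj.
  have [i -> <-] := idxP _ sx; have [k -> <-] := idxP _ sy.
  by move=> /val_inj ->.
pose chi := frename (omap h) psi.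
have chiP (g : name -> M) x : sat psi (oapp (g \o v) x) <-> sat chi (oapp (g \o f) x).
  rewrite sat_frename oapp_omap; split; apply: sP => -[y|] //= sy; by rewrite fE.
pose c := Witness f [set chi]; exists c.
have := good_real F_good (f := f) (p := [set chi]) I.
have gE (w : _ -> name) (g : name -> M) d : g \o oapp w d = oapp (g \o w) (g d).
  by apply/funext => -[].
move=> /(_ _ chi erefl) Fc.
have -> : [set g : name -> M | sat psi (g \o oapp v c)] =
          [set g : name -> M | sat chi (g \o oapp f c)].
  by apply/seteqP; split=> g /=; rewrite !gE => /chiP.
apply: Fc => q fq qchi; apply: measured_mono Fex _ _.
  by move=> g [x /chiP satx]; exists x => theta /qchi ->.
by apply: supported_sub (@supported_satisfiable _ M _ f _ fq).
Qed.

Lemma comp_oapp (V : Type) (w : V -> name) (g : name -> M) c :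
  g \o oapp w c = oapp (g \o w) (g c).
Proof. by apply/funext => -[]. Qed.

Lemma fint_name (f : Defs.fsym L) (args : 'I_(far f) -> name) :
  exists c, F [set g : name -> M | g c = fint (fun i => g (args i))].
Proof.
pose psi : formula L (option 'I_(far f)) :=
  FEq (TVar L None) (TApp (fun i => TVar L (some i))).
have [|c Fc] := @henkin _ psi args.
  by apply: measured_all => g; exists (fint (fun i => g (args i))).
by exists c.
Qed.

Definition canonical_model : structure L :=
  @Structure L element
    (fun f args => class (projT1 (cid (fint_name (fun i => sval (args i))))))
    (fun R args => F [set g : name -> M | rint (fun i => g (sval (args i)))])
    (inhabits (class (BaseName L K))).

Notation N := canonical_model.

Lemma measured_congr (I : finType) (u v : I -> name) :
  (forall i, eqname (u i) (v i)) -> F [set g : name -> M | forall i, g (u i) = g (v i)].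
Proof.
move=> uv; have Fuv := @measured_finite _ [set: I]
  (fun i => [set g : name -> M | g (u i) = g (v i)]) finite_finset (fun i _ => uv i).
by congr (F _): Fuv; apply/seteqP; split=> g /= gE i //; exact: gE.
Qed.

Lemma measured_teval (V : Type) (t : term L V) (v : V -> name) (c : name) :
  supported setT [set g : name -> M | teval t (g \o v) = g c].
Proof.
have [s fs [sD sP]] := @measured_sat _ (FEq (trename some t) (TVar L None)) (oapp v c).
exists s => //; split=> // g g' gg' /=.
by move: (sP g g' gg'); rewrite /= !teval_trename !comp_oapp.
Qed.

Lemma teval_canonical (V : Type) (t : term L V) (v : V -> name) :
  exists2 c, @teval L N V t (class \o v) = class c &
    F [set g : name -> M | teval t (g \o v) = g c].
Proof.
elim: t => [x|f ts IH]; first by exists (v x) => //; exact: measured_all.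
have [c cP] := choice (fun i => let: ex_intro2 c p q := IH i in ex_intro _ c (conj p q)).
rewrite /=; case: cid => d /= Fd; exists d => //.
have {}Fd : F [set g : name -> M | g d = fint (fun i => g (repr (c i)))].
  congr (F _): Fd; apply/seteqP; split=> g /= ->; congr fint; apply/funext => i;
  by rewrite (cP i).1.
have Fc := measured_congr (fun i => eqname_class (c i)).
have Ft := @measured_finite _ [set: 'I_(far f)]
  (fun i => [set g : name -> M | teval (ts i) (g \o v) = g (c i)]) finite_finset (fun i _ => (cP i).2).
apply: measured_mono (good_setI F_good Fd (good_setI F_good Fc Ft)) _ _.
  move=> g [/= -> [gc gt]]; congr fint; apply/funext => i.
  by rewrite gc; exact: gt.
exact: (measured_teval (TApp ts)).
Qed.

(** In the universal case, if the set of assignments were not in [F], its complement would be, and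
    [henkin] would name a counterexample, against the induction hypothesis. *)
Theorem Los (V : Type) (phi : formula L V) (v : V -> name) :
  @sat L N V phi (class \o v) <-> F [set g : name -> M | sat phi (g \o v)].
Proof.
elim: phi v => {V} [V|V t u|V R ts|V phi IHphi psi IHpsi|V phi IH] v /=.
- split=> // F0; apply: (good_set0 F_good); congr (F _): F0.
- have [c -> Fc] := teval_canonical t v; have [d -> Fd] := teval_canonical u v.
  rewrite class_eq; split=> [cd|tu].
    apply: measured_mono (good_setI F_good cd (good_setI F_good Fc Fd)) _ _.
      by move=> g [/= gcd [-> ->]].
    exact: (measured_sat (FEq t u)).
  apply: measured_mono (good_setI F_good tu (good_setI F_good Fc Fd)) _ (measured_eq _ _).
  by move=> g [/= gtu [<- <-]].
- have [c cP] := choice (fun i => let: ex_intro2 c p q := teval_canonical (ts i) v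
    in ex_intro _ c (conj p q)).
  rewrite (_ : mkset _ = [set g : name -> M | rint (fun i => g (sval (class (c i))))]).
  2: by apply/funext => g; congr rint; apply/funext => i; rewrite (cP i).1.
  have Fc := measured_congr (fun i => eqname_class (c i)).
  have Ft := @measured_finite _ [set: 'I_(rar R)]
    (fun i => [set g : name -> M | teval (ts i) (g \o v) = g (c i)]) finite_finset (fun i _ => (cP i).2).
  have Fct := good_setI F_good Fc Ft.
  have gE (g : name -> M) : (forall i, g (sval (class (c i))) = g (c i)) /\
      (forall i, setT i -> teval (ts i) (g \o v) = g (c i)) ->
      (fun i => g (sval (class (c i)))) = (fun i => teval (ts i) (g \o v)).
    by move=> [gc gt]; apply/funext => i; rewrite gc gt.
  split=> FR; apply: measured_mono (good_setI F_good FR Fct) _ _.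
  + by move=> g [/= Rg /gE <-].
  + exact: (measured_sat (FRel ts)).
  + by move=> g [/= Rg /gE ->].
  + exact: (measured_sat (FRel (fun i => TVar L i)) (fun i => sval (class (c i)))).
- rewrite IHphi IHpsi; split=> [imp|imp Fphi].
    apply: (good_ultra (c := BaseName L K) F_good I (measured_sat (FImp phi psi) v)) => Fn.
    have Fpsi : F [set g : name -> M | sat psi (g \o v)].
      apply: imp; apply: measured_mono Fn _ (measured_sat _ _).
      by move=> g /= /not_implyP[].
    have [g [/= /not_implyP[_ npsi] psig]] := good_neq0 F_good (good_setI F_good Fn Fpsi).
    exact: npsi.
  apply: measured_mono (good_setI F_good imp Fphi) _ (measured_sat _ _).
  by move=> g /= [] gi /gi.
- have cE c : oapp (class \o v) (class c) = class \o oapp v c by apply/funext => -[].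
  split=> [all|all x].
    apply: (good_ultra (c := BaseName L K) F_good I (measured_sat (FAll phi) v)) => Fn.
    have [|c Fc] := @henkin _ (FNot phi) v.
      congr (F _): Fn; apply/seteqP; split=> g /=; first by move/existsNP.
      by move=> [x nphi] /(_ x).
    have := all (class c); rewrite cE IH => Fphi.
    by have [g [/= ng pg]] := good_neq0 F_good (good_setI F_good Fc Fphi); apply: ng.
  rewrite -(class_sval x) cE IH; apply: measured_mono all _ (measured_sat _ _).
  by move=> g /= all; rewrite comp_oapp.
Qed.

(** Indexing the small set of parameters by [K] turns a type over it into a set [p'] of formulas
    over a sequence [f] of names. By [Los], finite satisfiability in the model holds almost
    everywhere, so [Witness f p'] realizes the type. *)
Lemma canonical_saturated : saturated N K.
Proof.
move=> A /card_le_total[h injh] p psat.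
pose v (c : {c : N | A c}) : name := sval (sval c).
have [f fE] := @recode _ setT h v (fun x y _ _ => @injh x y).
pose p' := [set frename (omap h) psi | psi in p].
have fN : class \o f \o h = sval.
  by apply/funext => x /=; rewrite fE // class_sval.
have cE c : sval = class \o v :> ({c : N | A c} -> N).
  by apply/funext => x /=; rewrite /v class_sval.
exists (class (Witness f p')) => psi ppsi.
have Fp := good_real F_good (f := f) (p := p') I.
have {Fp}: F [set g : name -> M | sat (frename (omap h) psi) (g \o oapp f (Witness f p'))].
  apply: Fp; last by exists psi.
  move=> q fq qp.
  have [phi phiP] := definable_ex (finite_conjunction fq).
  rewrite (_ : satisfiable_set f q = [set g : name -> M | sat phi (g \o f)]); last first.
    by apply/seteqP; split=> g /phiP.
  rewrite -Los -phiP.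
  have [|w wP] := choice (P := fun theta psi => q theta ->
      p psi /\ frename (omap h) psi = theta).
    move=> theta; have [/qp[psi' ? ?]|nq] := pselect (q theta); first by exists psi'.
    by exists FBot.
  have [||x xP] := psat (w @` q).
  - exact: finite_image.
  - by move=> _ [theta /wP[? _] <-].
  exists x => theta qtheta; rewrite -(wP _ qtheta).2 sat_frename oapp_omap fN.
  by apply: xP; exists theta.
rewrite -Los sat_frename.
by congr (sat _ _); apply/funext => -[x|] //=; rewrite fE // class_sval.
Qed.

End CanonicalModel.

Theorem saturated_equivalent (L : language) (M : structure L) (X : Type) :
  exists (kappa : Type) (N : structure L),
    [/\ ~ ([set: kappa] #<= [set: X]), saturated N kappa,
      (forall A : set N, finite_set A -> small kappa A) &
      forall sigma : sentence L, sat sigma (of_void N) <-> sat sigma (of_void M)].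
Proof.
(* [set X] makes [kappa] larger than [X] by Cantor's argument, and [nat] makes it infinite, so that
   finite sets are small. *)
pose kappa := (nat + set X)%type.
have code_inj : injective (inl : nat -> kappa) by move=> x y [].
have [F F_good] := @exists_good L M kappa (inl 0%N).
exists kappa, (canonical_model code_inj F_good); split.
- move=> /card_leT_inj[f injf _].
  by apply: (@Cantor X (fun S => f (inr S))) => S S' /injf [].
- exact: canonical_saturated.
- move=> A fA /card_leT_inj[f injf Af].
  apply: infinite_nat; apply: card_le_finite fA.
  by apply: (@card_le_injT _ _ (f \o inl)) => [x y /injf /code_inj|x /=].
- move=> sigma.
  have vE Y (v : void -> Y) : v = of_void Y by apply/funext => -[].
  rewrite -(vE _ (class F_good \o of_void _)) Los.
  split=> [Fsat|satM].
    by have [g] := good_neq0 F_good Fsat; rewrite /= (vE _ (g \o _)).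
  by apply: measured_all => // g; rewrite /= (vE _ (g \o _)).
Qed.

(** * Algebraic closure *)

Lemma finite_families (I : finType) (T : Type) (F : I -> set T) :
  (forall i, finite_set (F i)) -> finite_set [set u : I -> T | forall i, F i (u i)].
Proof.
move=> /finite_bigcup_fin/finite_rangeP[n [g gE]].
apply: (@sub_finite_set _ _ (range (fun h : {ffun I -> 'I_n} => g \o h))); last first.
  exact: finite_range.
move=> u uF; have gu i : exists j, g j = u i.
  have : (\bigcup_i F i) (u i) by exists i.
  by rewrite gE => -[j _ <-]; exists j.
have [h hE] := choice gu; exists [ffun i => h i] => //.
by apply/funext => i /=; rewrite ffunE.
Qed.

Section AlgebraicClosure.
Variables (L : language) (N : structure L).
Implicit Types (A B C D : set N) (x y : N).

Lemma acl_intro A (V : Type) (phi : formula L (option V)) (c : V -> N) x :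
  (forall v, A (c v)) -> finite_set [set y | sat phi (oapp c y)] ->
  sat phi (oapp c x) -> acl A x.
Proof.
move=> Ac fin phix.
pose h (w : option V) : 'I_1 + {a | A a} :=
  if w is Some v then inr (exist _ (c v) (Ac v)) else inl ord0.
have hE (z : 'I_1 -> N) : join z sval \o h = oapp c (z ord0).
  by apply/funext => -[].
exists [set z | sat (frename h phi) (join z sval)]; split.
- by exists (frename h phi).
- apply: (@sub_finite_set _ _ ((fun y (_ : 'I_1) => y) @` [set y | sat phi (oapp c y)])).
    move=> z /=; rewrite sat_frename hE => zphi; exists (z ord0) => //.
    by apply/funext => i; rewrite (ord1 i).
  exact: finite_image.
- by rewrite /= sat_frename hE.
Qed.

Lemma acl_elim A x : acl A x -> exists phi : formula L (option {a | A a}),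
  sat phi (oapp sval x) /\ finite_set [set y | sat phi (oapp sval y)].
Proof.
move=> [X [[phi XE] fX Xx]].
pose h (w : 'I_1 + {a | A a}) := if w is inr a then Some a else None.
have hE y : oapp sval y \o h = join (fun=> y) sval by apply/funext => -[].
exists (frename h phi); rewrite sat_frename hE; split; first by rewrite XE in Xx.
have -> : [set y | sat (frename h phi) (oapp sval y)] = (fun y (_ : 'I_1) => y) @^-1` X.
  by apply/seteqP; split=> y /=; rewrite sat_frename hE XE.
by apply: finite_preimage fX => y z _ _ /(congr1 (@^~ ord0)).
Qed.

Lemma acl_elim_fin A x : acl A x -> exists n (c : 'I_n -> N) (phi : formula L (option 'I_n)),
  [/\ forall i, A (c i), sat phi (oapp c x) & finite_set [set y | sat phi (oapp c y)]].
Proof.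
move=> /acl_elim[phi [phix fphi]]; have [s fs sP] := sat_support phi.
have [n [u uE]] : exists n (u : 'I_n -> {a | A a}), some @^-1` s = range u.
  by apply/finite_rangeP; apply: finite_preimage fs => a b _ _ [].
pose h (w : option {a | A a}) : option 'I_n := obind (fun a => [pick i | `[< u i = a >]]) w.
have hE y w : s w -> (oapp (sval \o u) y \o h) w = oapp sval y w.
  case: w => [a|] //= sa; case: pickP => [i /asboolP <- //|nu].
  have [i _ ui] : range u a by rewrite -uE.
  by have /asboolP := nu i; rewrite ui.
have satE y : sat (frename h phi) (oapp (sval \o u) y) <-> sat phi (oapp sval y).
  by rewrite sat_frename; split; apply: sP => w /(hE y).
exists n, (sval \o u), (frename h phi); split.
- by move=> i /=; exact: svalP.
- exact/satE.
- rewrite (_ : mkset _ = [set y | sat phi (oapp sval y)]) //.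
  by apply/seteqP; split=> y /satE.
Qed.

Lemma acl_sub A : A `<=` acl A.
Proof.
move=> x Ax; apply: (@acl_intro _ unit (FEq (TVar L None) (TVar L (Some tt))) (fun=> x)) => //=.
by rewrite (_ : mkset _ = [set x]) //; exact: finite_set1.
Qed.

Lemma acl_mono A B : A `<=` B -> acl A `<=` acl B.
Proof.
move=> AB x /acl_elim[phi [phix fphi]].
by apply: acl_intro fphi phix => -[a Aa] /=; exact: AB.
Qed.

Lemma acl_finite_character A x : acl A x -> exists2 A0, finite_set A0 & A0 `<=` A /\ acl A0 x.
Proof.
move=> /acl_elim_fin[n [c [phi [Ac phix fphi]]]]; exists (range c); first exact: finite_range.
split=> [_ [i _ <-] //|]; by apply: acl_intro fphi phix => i; exists i.
Qed.

(** The formula for [x] asks for a tuple [u] that solves all [theta i], for which [phi] holds of [x]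
    and has at most [k] solutions. The last clause keeps the union over [u] finite, since [phi]
    could have infinitely many solutions for another [u]. *)
Lemma acl_idem A : acl (acl A) `<=` acl A.
Proof.
move=> x /acl_elim_fin[n [c [phi [Ac phix fphi]]]].
have [theta thetaP] := choice (fun i => acl_elim (Ac i)).
have [k kP] : exists k, [set y | sat phi (oapp c y)] #<= `I_k by apply/finite_set_leP.
pose h i (w : option {a | A a}) : 'I_n + option {a | A a} :=
  if w is Some a then inr (Some a) else inl i.
pose h' (w : option 'I_n) : 'I_n + option {a | A a} :=
  if w is Some i then inl i else inr None.
have /definable_ex_tuple[psi psiP] := definable_and
  (definable_forall_fin (fun i => definable_comp (h i) (definable_sat (theta i))))
  (definable_and (definable_comp h' (definable_sat phi))
    (definable_comp inl (definable_not (definable_card_ge k.+1 (definable_sat phi))))).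
have hE (u : 'I_n -> N) (y : N) i : join u (oapp sval y) \o h i = oapp sval (u i).
  by apply/funext => -[].
have hE' (u : 'I_n -> N) (y : N) : join u (oapp sval y) \o h' = oapp u y.
  by apply/funext => -[].
have hE'' (u : 'I_n -> N) (y : N) : join u (oapp (@sval N A) y) \o inl = u.
  by apply/funext.
apply: (@acl_intro _ _ psi sval); first by case.
  pose U := [set u : 'I_n -> N | forall i, [set y | sat (theta i) (oapp sval y)] (u i)].
  pose S := [set u | U u /\ ~ (`I_k.+1 #<= [set y | sat phi (oapp u y)])].
  apply: (@sub_finite_set _ _ (\bigcup_(u in S) [set y | sat phi (oapp u y)])).
    move=> y /psiP[u [thu [phiu nk]]]; exists u; last by rewrite /= -hE'.
    by split=> [i|]; [rewrite /= -(hE u y); exact: thu|by move: nk; rewrite hE''].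
  apply: bigcup_finite.
    apply: (@sub_finite_set _ _ U); first by move=> u [].
    apply: (@finite_families _ _ (fun i => [set y | sat (theta i) (oapp sval y)])) => i.
    by have [] := thetaP i.
  move=> u [_ nk]; apply: contrapT => /infiniteP inf; apply: nk.
  exact: card_le_trans (card_leT _) inf.
apply/psiP; exists c; split=> [i|]; first by rewrite hE; have [] := thetaP i.
split; first by rewrite hE'.
rewrite hE'' => k1; have := card_le_trans k1 kP.
by rewrite card_le_II ltnn.
Qed.

Lemma acl_subset A B : A `<=` acl B -> acl A `<=` acl B.
Proof. by move=> /acl_mono AB; apply: subset_trans AB _; exact: acl_idem. Qed.

End AlgebraicClosure.

(** * Exchange and independence *)

Section Pregeometry.
Variables (L : language) (N : structure L).
Hypothesis exch : acl_exchange N.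
Implicit Types (A B C D F X : set N) (x y w : N).

Definition acl_free (J : Type) D (a : J -> N) (S : set J) :=
  forall i, S i -> ~ acl (D `|` a @` (S `\ i)) (a i).

Lemma acl_setU D A B : A `<=` acl (D `|` B) -> acl (D `|` A) `<=` acl (D `|` B).
Proof.
by move=> AB; apply: acl_subset => x [Dx|/AB //]; apply: acl_sub; left.
Qed.

(** If some [a i] became algebraic by the addition of [a j], exchange would make [a j] algebraic
    over the old family. *)
Lemma free_add (J : Type) D (a : J -> N) (S : set J) j :
  acl_free D a S -> ~ acl (D `|` a @` S) (a j) -> acl_free D a (j |` S).
Proof.
move=> fS naj i Si aclai.
have [ij|ij] := pselect (i = j).
  apply: naj; rewrite -ij; apply: acl_mono aclai; apply: setUS.
  by apply: image_subset => k [[kj|//] ki]; case: ki; rewrite ij.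
have {}Si : S i by case: Si.
apply: naj; have := @exch (D `|` a @` (S `\ i)) (a j) (a i).
move=> /(_ _ (fS i Si)) h; apply: acl_mono (h _).
  by move=> x [[Dx|[k [Sk _] <-]]|->]; [left|right; exists k|right; exists i].
apply: acl_mono aclai => x [Dx|[k [[->|Sk] ki] <-]]; [by left; left|by right|].
by left; right; exists k.
Qed.

Lemma free_cons n D (a : 'I_n -> N) x :
  acl_free D a setT -> ~ acl (D `|` range a) x ->
  acl_free D (fun i : 'I_n.+1 => oapp a x (unlift ord0 i)) setT.
Proof.
move=> fa nx; set a' := fun i => _.
have a'E k : a' (lift ord0 k) = a k by rewrite /a' liftK.
have liftP i : i <> ord0 -> exists k : 'I_n, i = lift ord0 k.
  by case: (unliftP ord0 i) => [k ->|//] _; exists k.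
have -> : [set: 'I_n.+1] = ord0 |` [set i | i <> ord0].
  by apply/seteqP; split=> // i _; have [->|/eqP] := eqVneq i ord0; [left|right].
apply: free_add => [i /liftP[k ->]|].
  rewrite a'E => h; apply: (fa k I); apply: acl_mono h; apply: setUS.
  move=> _ [j [/liftP[l ->] lk] <-]; exists l => //; split=> // lk'; apply: lk.
  by rewrite /= lk'.
have -> : a' ord0 = x by rewrite /a' unlift_none.
move=> h; apply: nx; apply: acl_mono h; apply: setUS.
by move=> _ [j /liftP[l ->] <-]; exists l.
Qed.

Lemma basis_exists D F : finite_set F -> exists n (a : 'I_n -> N),
  [/\ forall i, F (a i), acl_free D a setT & F `<=` acl (D `|` range a)].
Proof.
move: F; apply: finite_set_elim.
  by exists 0%N, (fun i : 'I_0 => match notF (ltn_ord i) with end); split=> [[]|[]|].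
move=> x F _ [n [a [Fa fa Fsub]]].
have [ax|nax] := pselect (acl (D `|` range a) x).
  by exists n, a; split=> // [i|_ [->|/Fsub]//]; right.
exists n.+1, (fun i => oapp a x (unlift ord0 i)); split.
- by move=> i; case: unliftP => [k _|_] /=; [right|left].
- exact: free_cons.
- move=> y [->|/Fsub].
    by apply: acl_sub; right; exists ord0 => //; rewrite unlift_none.
  apply: acl_mono; apply: setUS => _ [k _ <-].
  by exists (lift ord0 k) => //; rewrite liftK.
Qed.

(* A tuple is free over [D] iff its dimension over [D] is its length. *)
Lemma indep_free n A B D (a : 'I_n -> N) : indep A D B -> (forall i, A (a i)) ->
  acl_free D a setT -> acl_free (B `|` D) a setT.
Proof.
move=> AB Aa fa i _ aclai; have := AB n a Aa.
suff [-> lt] : acl_dim a D = n /\ (acl_dim a (B `|` D) < n)%N.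
  by move=> e; rewrite e ltnn in lt.
split.
  rewrite /acl_dim; case: arg_minnP => [|S /asboolP SE _].
    by apply/asboolP; congr (acl (_ `|` _)); apply/seteqP; split=> [_ [j _ <-]|_ [j _ <-]]; exists j => //=; rewrite inE.
  suff -> : S = [set: 'I_n]%SET by rewrite cardsT card_ord.
  apply/setP => j; rewrite inE; apply/negP => /negP jS.
  apply: (fa j I); have : acl (a @` [set` S] `|` D) (a j).
    by rewrite -SE; apply: acl_sub; left; exists j.
  apply: acl_mono => z [[k /= kS <-]|Dz]; [right|by left].
  by exists k => //; split=> //= kj; rewrite -kj kS in jS.
rewrite /acl_dim; case: arg_minnP => [|S _ Smin].
  by apply/asboolP; congr (acl (_ `|` _)); apply/seteqP; split=> [_ [j _ <-]|_ [j _ <-]]; exists j => //=; rewrite inE.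
apply: (@leq_ltn_trans #|[set~ i]%SET|); last first.
  by rewrite cardsC1 card_ord prednK // (leq_ltn_trans _ (ltn_ord i)).
apply: Smin; apply/asboolP/seteqP; split; last first.
  by apply: acl_mono; apply: setSU => _ [k _ <-]; exists k.
apply: acl_subset => z [[k _ <-]|?]; last by apply: acl_sub; right.
have [->|ki] := eqVneq k i; last first.
  by apply: acl_sub; left; exists k => //=; rewrite !inE.
apply: acl_mono aclai => u [Dz|[j [_ ji] <-]]; [by right|left].
by exists j => //=; rewrite !inE; apply/eqP.
Qed.

(** Otherwise [w] and a basis of [F] over [D] would form a tuple free over [D], hence free over [B]
    and [D] by independence, contrary to the assumption on [w]. *)
Lemma indep_acl A B D F w : indep A D B -> finite_set F -> F `<=` A -> A w ->
  acl (B `|` D `|` F) w -> acl (D `|` F) w.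
Proof.
move=> AB fF FA Aw aclw; apply: contrapT => nw.
have [n [a [Fa fa Fsub]]] := basis_exists D fF.
have nwa : ~ acl (D `|` range a) w.
  apply: contra_not nw; apply: acl_mono; apply: setUS => _ [i _ <-]; exact: Fa.
have := indep_free AB _ (free_cons fa nwa).
move=> /(_ _ ord0 I); rewrite unlift_none /=; apply.
  by move=> i; case: unliftP => [k _|_] //=; exact/FA/Fa.
have /acl_setU : F `<=` acl ((B `|` D) `|` range a).
  by move=> x /Fsub; apply: acl_mono; apply: setSU; right.
move=> /(_ w aclw); apply: acl_mono; apply: setUS => _ [i _ <-].
by exists (lift ord0 i); [split=> // /eqP|rewrite liftK].
Qed.

(** Symmetry: independence is given for tuples of [C] and used for elements of [Q]. A finite basis
    of the elements of [C] involved is removed one by one; if the removal of [c i] mattered for [w],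
    exchange would make [c i] algebraic over [Q], [D] and the rest of the basis. *)
Lemma indep_acl_sym C D Q F w : indep C D Q -> F `<=` Q -> Q w ->
  acl (F `|` D `|` C) w -> acl (F `|` D) w.
Proof.
move=> CQ FQ Qw /acl_finite_character[X fX [XFDC aclw]].
have fC0 : finite_set (X `&` C) by exact: finite_setIl.
have [n [c [Cc fc Csub]]] := basis_exists D fC0.
have fcQ := indep_free CQ (fun i => (Cc i).2) fc.
have {}aclw : acl (F `|` D `|` range c) w.
  suff : X `<=` acl (F `|` D `|` range c) by move/acl_subset; exact.
  move=> x Xx; case: (XFDC x Xx) => [FDx|Cx]; first by apply: acl_sub; left.
  have := Csub x (conj Xx Cx); apply: acl_mono; apply: setSU; by right.
have : finite_set [set: 'I_n] by exact: finite_finset.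
move: aclw; rewrite -[range c]/(c @` setT); move: setT => S aclw fS; move: S fS aclw.
apply: finite_set_elim => [|i S _ IH aclw]; first by rewrite image_set0 setU0.
have [//|nw] := pselect (acl (F `|` D) w).
have [Si|nSi] := pselect (S i).
  by apply: IH; rewrite (_ : S = i |` S) //; apply/seteqP; split=> [j|j [->|]//]; right.
exfalso; apply: (fcQ i I).
have /(@exch _ (c i) w) h : acl ((F `|` D `|` c @` S) `|` [set c i]) w.
  apply: acl_mono aclw => x [FDx|[j [->|Sj] <-]]; [by left; left|by right|].
  by left; right; exists j.
apply: acl_mono (h (fun e => nw (IH e))) => x [[[Fx|Dx]|[j Sj <-]]|->].
- by left; left; apply: FQ.
- by left; right.
- by right; exists j => //; split=> // ji; rewrite ji in Sj.
- by left; left.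
Qed.

End Pregeometry.

(** * Realizing types generically *)

Section Saturated.
Variables (L : language) (N : structure L) (kappa : Type).
Hypothesis N_saturated : saturated N kappa.
Hypothesis finite_small : forall A : set N, finite_set A -> small kappa A.
Implicit Types (A B C D F Q X Z : set N) (x y w : N).

(** Coordinates are added one at a time: the type of [v n] over [Q] and the earlier coordinates is
    transported to [u] and realized by saturation. If it is not algebraic, its formulas have
    infinitely many solutions, which leaves room to avoid the closure of [Z] and the earlier
    coordinates. *)
Lemma nonalgebraic_copy Q Z (v : nat -> N) n : finite_set Q -> finite_set Z ->
  exists u : nat -> N,
    (forall theta : formula L ('I_n + {c | Q c}),
       sat theta (join (v \o @nat_of_ord _) sval) -> sat theta (join (u \o @nat_of_ord _) sval)) /\
    (forall i, (i < n)%N -> ~ acl (Q `|` v @` `I_i) (v i) ->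
       ~ acl (Z `|` u @` `I_i) (u i)).
Proof.
move=> fQ fZ; elim: n => [|n [u [uv unalg]]].
  exists v; split=> // theta; congr (sat theta); by apply/funext => -[[]|].
pose h (s : 'I_n.+1 + {c | Q c}) : option ('I_n + {c | Q c}) := match s with
  | inl i => if unlift ord_max i is Some k then Some (inl k) else None
  | inr c => Some (inr c) end.
have hE (t t' : nat -> N) : (forall i, (i < n)%N -> t i = t' i) ->
    oapp (join (t \o @nat_of_ord n) (@sval N Q)) (t' n) \o h =
    join (t' \o @nat_of_ord _) sval.
  move=> tt'; apply/funext => -[i|c] //=; case: unliftP => [k|] -> //=.
  by rewrite /bump leqNgt ltn_ord tt'.
pose A := Z `|` Q `|` u @` `I_n.
have fA : finite_set A.
  by rewrite /A !finite_setU; split; [split|exact/finite_image/finite_II].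
have QA c : Q c -> A c by left; right.
have uA (k : 'I_n) : A (u k) by right; exists (nat_of_ord k) => //=.
pose g (s : 'I_n + {c | Q c}) : {c | A c} := match s with
  | inl k => exist _ (u k) (uA k) | inr c => exist _ (sval c) (QA _ (svalP c)) end.
have gE : sval \o g = join (u \o @nat_of_ord _) sval by apply/funext => -[].
pose p1 := [set psi | exists2 theta, frename (omap g \o h) theta = psi &
  sat theta (join (v \o @nat_of_ord _) (@sval N Q))].
(* A realization of all formulas with cofinite solution set is not algebraic over [A]. If [v n] is
   algebraic, [p2] is empty. *)
pose p2 := [set psi : formula L (option {c | A c}) | ~ acl (Q `|` v @` `I_n) (v n) /\
  finite_set [set x | ~ sat psi (oapp sval x)]].
have [x xP] : exists x, forall psi, (p1 `|` p2) psi -> sat psi (oapp sval x).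
  apply: (N_saturated (finite_small fA)) => q fq qp.
  have [|t tP] := choice (P := fun psi theta => p1 psi ->
      frename (omap g \o h) theta = psi /\ sat theta (join (v \o @nat_of_ord _) (@sval N Q))).
    move=> psi; have [[theta ? ?]|nq] := pselect (p1 psi); first by exists theta.
    by exists FBot.
  have ft : finite_set (t @` (q `&` p1)) by exact/finite_image/finite_setIl.
  have [chi chiP] := definable_comp h (finite_conjunction ft).
  have chiv : sat chi (oapp (join (v \o @nat_of_ord n) (@sval N Q)) (v n)).
    by apply/chiP; rewrite (hE v v) // => _ [psi [_ /tP[_ ?]] <-].
  have chiu x : sat chi (oapp (join (u \o @nat_of_ord n) (@sval N Q)) x) ->
      forall psi, q psi -> p1 psi -> sat psi (oapp sval x).
    move=> /chiP tx psi qpsi p1psi; have [<- _] := tP psi p1psi.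
    rewrite sat_frename compA oapp_omap gE; apply: tx.
    by exists psi.
  have [alg|nalg] := pselect (acl (Q `|` v @` `I_n) (v n)).
    have [phi phiP] := definable_ex (definable_sat chi).
    have /phiP[x /chiu xq] : sat phi (join (u \o @nat_of_ord n) (@sval N Q)).
      by apply: uv; apply/phiP; exists (v n).
    by exists x => psi qpsi; case: (qp _ qpsi) => [/(xq _ qpsi)//|[]].
  (* Having more than [k] solutions is a formula and passes from [v] to [u]; so a bound for [u]
     would hold for [v] and make [v n] algebraic. *)
  have inf : infinite_set
      [set x | sat chi (oapp (join (u \o @nat_of_ord n) (@sval N Q)) x)].
    move=> /finite_set_leP[k kle]; have [phi phiP] := definable_card_ge k.+1 (definable_sat chi).
    have [/phiP/uv/phiP kge|nge] := pselect (`I_k.+1 #<=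
        [set x | sat chi (oapp (join (v \o @nat_of_ord n) (@sval N Q)) x)]).
      by have := card_le_trans kge kle; rewrite card_le_II ltnn.
    apply: nalg; apply: acl_intro chiv.
      by case=> [i|[c Qc]]; [right; exists (nat_of_ord i) => //=|left].
    apply: contrapT => /infiniteP inf; apply: nge; exact: card_le_trans (card_leT _) inf.
  have fbad : finite_set (\bigcup_(psi in q `&` p2) [set x | ~ sat psi (oapp sval x)]).
    by apply: bigcup_finite => [|psi [_ []]//]; exact: finite_setIl.
  have /infinite_setN0[x [/chiu xq nbad]] := infinite_setD inf fbad.
  exists x => psi qpsi; case: (qp _ qpsi) => [/(xq _ qpsi)//|p2psi].
  by apply: contrapT => npsi; apply: nbad; exists psi.
pose u' i := if i == n then x else u i.
have u'E i : (i < n)%N -> u i = u' i by rewrite /u'; case: eqP => // ->; rewrite ltnn.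
have u'n : u' n = x by rewrite /u' eqxx.
have u'I i : (i <= n)%N -> u' @` `I_i = u @` `I_i.
  move=> il; apply/seteqP; split=> [_ [k kl <-]|_ [k kl <-]]; exists k => //.
    by rewrite u'E // (leq_trans _ il).
  by rewrite -u'E // (leq_trans _ il).
exists u'; split=> [theta thv|i].
  have := xP (frename (omap g \o h) theta); rewrite sat_frename compA oapp_omap gE -u'n.
  by rewrite (hE u u') //; apply; left; exists theta.
rewrite ltnS leq_eqVlt => /predU1P[->|il].
  move=> nalg aclx.
  have /acl_elim[theta [thx fth]] : acl A x.
    rewrite -u'n; apply: acl_mono aclx; rewrite u'I //.
    by move=> y [Zy|[k kl <-]]; [left; left|right; exists k].
  have : sat (FNot theta) (oapp sval x).
    apply: xP; right; split=> //; congr finite_set: fth.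
    by apply/seteqP; split=> y /= => [?|/contrapT]; [apply|].
  by apply.
by rewrite u'I ?(ltnW il) // -u'E //; exact: unalg.
Qed.

End Saturated.

(** * Multiplication of one block of coordinates *)

Lemma finite_card_le (T : Type) (A : set T) (k : nat) :
  ~ (`I_k #<= A) -> finite_set A.
Proof.
move=> nk; apply: contrapT => /infiniteP inf; apply: nk.
exact: card_le_trans (card_leT _) inf.
Qed.

Section Multiplication.
Variables (L : language) (N : structure L) (kappa : Type).
Hypothesis N_saturated : saturated N kappa.
Hypothesis finite_small : forall A : set N, finite_set A -> small kappa A.
Hypothesis exch : acl_exchange N.
Hypothesis wlm : forall A B : set N, small kappa A -> small kappa B ->
  exists C : set N, [/\ small kappa C, indep C set0 (A `|` B)
    & indep A (acl (A `|` C) `&` acl (B `|` C)) B].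
Implicit Types (A B C D F Q X Z : set N) (x y w : N).

(** Algebraicity is witnessed by a formula together with a bound on the number of its solutions, and
    both belong to the type over [Q]. *)
Lemma acl_transfer Q D (v u : nat -> N) n i : D `<=` Q -> (i < n)%N ->
  (forall theta : formula L ('I_n + {c | Q c}),
     sat theta (join (v \o @nat_of_ord _) sval) ->
     sat theta (join (u \o @nat_of_ord _) sval)) ->
  acl (D `|` v @` `I_i) (v i) -> acl (D `|` u @` `I_i) (u i).
Proof.
move=> DQ il vu /acl_elim_fin[m [c [phi [Dc phiv fphi]]]].
have /choice[h hP] : forall j, exists s : 'I_n + {c | Q c},
    join (v \o @nat_of_ord _) sval s = c j /\
    (D `|` u @` `I_i) (join (u \o @nat_of_ord _) sval s).
  move=> j; case: (Dc j) => [Dcj|[k ki <-]].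
    by exists (inr (exist _ _ (DQ _ Dcj))); split=> //; left.
  by exists (inl (Ordinal (ltn_trans ki il))); split=> //=; right; exists k.
have [k kle] : exists k, [set y | sat phi (oapp c y)] #<= `I_k by apply/finite_set_leP.
pose g (s : option 'I_m) : 'I_n + {c | Q c} :=
  if s is Some j then h j else inl (Ordinal il).
have [theta thetaP] := definable_and (definable_comp g (definable_sat phi))
  (definable_comp h (definable_not (definable_card_ge k.+1 (definable_sat phi)))).
have /thetaP/= [phiu nk] : sat theta (join (u \o @nat_of_ord _) (@sval N Q)).
  apply/vu/thetaP => /=.
  have -> : join (v \o @nat_of_ord _) sval \o g = oapp c (v i).
    by apply/funext => -[j|] //=; exact: (hP j).1.
  have -> : join (v \o @nat_of_ord _) sval \o h = c.
    by apply/funext => j; exact: (hP j).1.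
  by split=> // kge; have := card_le_trans kge kle; rewrite card_le_II ltnn.
apply: (acl_intro (phi := phi) (c := join (u \o @nat_of_ord _) sval \o h)).
- by move=> j; exact: (hP j).2.
- exact: finite_card_le nk.
- by rewrite (_ : oapp _ _ = join (u \o @nat_of_ord _) sval \o g) //; apply/funext => -[].
Qed.

Lemma definable_over_mono A B n (X : set ('I_n -> N)) : A `<=` B ->
  definable_over A X -> definable_over B X.
Proof.
move=> AB [phi ->].
pose h (s : 'I_n + {c | A c}) : 'I_n + {c | B c} := match s with
  | inl i => inl i | inr c => inr (exist _ (sval c) (AB _ (svalP c))) end.
exists (frename h phi); apply/seteqP.
have hE (x : 'I_n -> N) : join x sval \o h = join x sval by apply/funext => -[].
by split=> x /=; rewrite sat_frename hE.
Qed.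

(** [v] is the block to multiply, [U] holds the blocks still to be treated, [P] the parameters and
    the blocks already multiplied. The last conclusion keeps the blocks in [U] non-algebraic when
    [v] is replaced by its copies, so that they can be multiplied in turn. *)
Lemma multiply_tuple (U P : set N) n (v : 'I_n -> N) (X : set ('I_n -> N)) (k : nat) :
  finite_set U -> finite_set P -> definable_over (U `|` P) X -> X v ->
  ~ (range v `<=` acl (U `|` P)) ->
  exists V : 'I_k -> 'I_n -> N, [/\ injective V, forall l, X (V l) &
    forall F w, F `<=` U -> U w -> ~ acl (F `|` P `|` range v) w ->
      ~ acl (F `|` P `|` \bigcup_l range (V l)) w].
Proof.
move=> fU fP defX Xv nalgv.
pose A := range v `|` P; pose B := U `|` P.
have fA : finite_set A by rewrite finite_setU; split=> //; exact: finite_range.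
have fB : finite_set B by rewrite finite_setU.
have [C [_ CAB ADB]] := wlm (finite_small fA) (finite_small fB).
set D := acl _ `&` _ in ADB.
have [i0 _] : exists i : 'I_n, True.
  apply: contrapT => n0; apply: nalgv => x [i _ _]; by case: n0; exists i.
pose t i := oapp v (v i0) (insub i : option 'I_n).
have tE (i : 'I_n) : t i = v i by rewrite /t valK.
have tv : t \o @nat_of_ord _ = v by apply/funext => i; exact: tE.
have tA i : A (t i) by rewrite /t; case: (insub i) => [j|]; left.
(* As [C] is independent from [A] and [B], it does not affect algebraicity between their
   elements. *)
have indepC F w : F `<=` A `|` B -> (A `|` B) w -> acl (F `|` C) w -> acl F w.
  move=> FAB ABw; have := @indep_acl_sym _ _ exch _ _ _ F w CAB FAB ABw.
  by rewrite !setU0.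
have /choice[D1 D1P] : forall i : 'I_n, exists Di, [/\ finite_set Di, Di `<=` D &
    acl (D `|` t @` `I_i) (t i) -> acl (Di `|` t @` `I_i) (t i)].
  move=> i; have [/acl_finite_character[X0 fX0 [X0D aclX0]]|na] :=
      pselect (acl (D `|` t @` `I_i) (t i)); last by exists set0; split.
  exists (X0 `&` D); split=> [||_]; [exact: finite_setIl|by move=> x []|].
  by apply: acl_mono aclX0 => x Xx; case: (X0D _ Xx); [left|right].
(* A finite part of [D]: besides [P] it contains, for each coordinate algebraic over [D] and the
   earlier ones, finitely many elements that witness this. *)
pose D' := P `|` \bigcup_i D1 i.
have fD' : finite_set D'.
  by rewrite finite_setU; split=> //; apply: finite_bigcup_fin => i; have [] := D1P i.
have D'D : D' `<=` D.
  move=> x [Px|[i _ Dx]]; last by have [_ + _] := D1P i; apply.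
  by split; apply: acl_sub; left; right.
pose Q := U `|` D'.
have fQ : finite_set Q by rewrite finite_setU.
(* Independence over [D] turns algebraicity over [Q] and the earlier coordinates into algebraicity
   over [D] and them, hence over [D'] and them. *)
have alg_or i : (i < n)%N ->
    acl (D' `|` t @` `I_i) (t i) \/ ~ acl (Q `|` t @` `I_i) (t i).
  move=> il; have [aclQ|] := pselect (acl (Q `|` t @` `I_i) (t i)); [left|by right].
  have : acl (D `|` t @` `I_i) (t i).
    apply: (indep_acl exch ADB) => //.
    - exact/finite_image/finite_II.
    - by move=> _ [j _ <-].
    - apply: acl_mono aclQ; apply: setSU => x [Ux|/D'D Dx]; [by left; left|by right].
  have [_ _ /[apply]] := D1P (Ordinal il); apply: acl_mono; apply: setSU => x Dx.
  by right; exists (Ordinal il).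
(* If all coordinates were algebraic over [Q], then [v] would be algebraic over [B] and [C], hence
   over [B]. *)
have [i1 i1n nalg1] : exists2 i, (i < n)%N & ~ acl (Q `|` t @` `I_i) (t i).
  apply: contrapT => alg; apply: nalgv => _ [i _ <-].
  have aclt j : (j < n)%N -> acl Q (t j).
    elim/ltn_ind: j => j IH jn.
    have : acl (Q `|` t @` `I_j) (t j) by apply: contrapT => na; apply: alg; exists j.
    apply: acl_subset => x [Qx|[l lj <-]]; first exact: acl_sub.
    by apply: IH => //; exact: ltn_trans lj jn.
  apply: indepC; [by right|by left; left; exists i|].
  rewrite -tE; apply: acl_subset (aclt i (ltn_ord i)) => x [Ux|/D'D[_ //]].
  by apply: acl_sub; left; left.
(* The induction on [k] works over [D']. Non-algebraicity over [P] and [v] implies it over [D'],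
   because [D'] is algebraic over [v], [P] and [C]. *)
suff [V [injV XV VP]] : exists V : 'I_k -> 'I_n -> N, [/\ injective V,
    forall l, X (V l) & forall F w, F `<=` U -> U w -> ~ acl (F `|` D') w ->
      ~ acl (F `|` D' `|` \bigcup_l range (V l)) w].
  exists V; split=> // F w FU Uw nw.
  have /VP : ~ acl (F `|` D') w.
    move=> h; apply: nw; apply: indepC; [|by right; left|].
      by move=> x [[/FU Ux|Px]|vx]; [right; left|right; right|left; left].
    apply: acl_subset h => x [Fx|/D'D[+ _]]; first by apply: acl_sub; left; left; left.
    by apply: acl_mono => y [[vy|Py]|Cy]; [left; right|left; left; right|right].
  move=> /(_ FU Uw); apply: contra_not; apply: acl_mono; apply: setSU; apply: setUS.
  by move=> x Px; left.
elim: k => [|k [V [injV XV VP]]].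
  exists (fun l : 'I_0 => match notF (ltn_ord l) with end); split; [by case|by case|].
  move=> F w _ _ nw; apply: contra_not nw; apply: acl_mono => x [//|[[l l0]]]; by [].
pose Y := \bigcup_l range (V l).
have fY : finite_set Y by apply: finite_bigcup_fin => l; exact: finite_range.
pose Z := Q `|` Y.
have fZ : finite_set Z by rewrite finite_setU.
have [u [uv unalg]] := nonalgebraic_copy N_saturated finite_small t n fQ fZ.
pose V' (l : 'I_k.+1) := oapp V (u \o @nat_of_ord n) (unlift ord0 l).
(* The coordinate [i1] of the new copy is not algebraic over [Z], which contains the earlier
   copies. *)
have un (l : 'I_k) : u \o @nat_of_ord n <> V l.
  move=> uV; apply: (unalg i1 i1n nalg1); apply: acl_sub; left; right; exists l => //.
  by exists (Ordinal i1n) => //; rewrite -uV.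
have V'Y : \bigcup_l range (V' l) = Y `|` u @` `I_n.
  apply/seteqP; split=> x.
    move=> [l _ [j _ <-]]; rewrite /V'; case: unliftP => [l' _|_] /=.
      by left; exists l' => //; exists j.
    by right; exists j => //=.
  move=> [[l _ [j _ <-]]|[j jn <-]].
    by exists (lift ord0 l) => //; exists j => //; rewrite /V' liftK.
  by exists ord0 => //; exists (Ordinal jn) => //; rewrite /V' unlift_none.
exists V'; split.
- move=> l l'; rewrite /V'; case: unliftP => [j ->|->]; case: unliftP => [j' ->|->] //=.
  + by move=> /injV ->.
  + by move=> /esym/un.
  + by move=> /un.
- move=> l; rewrite /V'; case: unliftP => [j _|_] //=.
  have [theta XE] : definable_over Q X.
    apply: definable_over_mono defX => x [Ux|Px]; [by left|by right; left].
  by move: Xv; rewrite XE -tv; exact: uv.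
- move=> F w FU Uw nw; rewrite V'Y setUA.
  have nw0 := VP F w FU Uw nw.
  (* An algebraic coordinate adds nothing to the closure. For another one, exchange would make [u i]
     algebraic over [Z] and the earlier coordinates. *)
  suff : forall i, (i <= n)%N -> ~ acl (F `|` D' `|` Y `|` u @` `I_i) w by apply.
  elim=> [_|i IH il].
    by rewrite (_ : `I_0 = set0) ?image_set0 ?setU0 //; apply/seteqP; split.
  have {}IH := IH (ltnW il).
  have IE : u @` `I_i.+1 `<=` u @` `I_i `|` [set u i].
    move=> _ [j + <-]; rewrite /= ltnS leq_eqVlt => /predU1P[->|ji]; [by right|].
    by left; exists j.
  have [algi|nalgi] := alg_or i il.
    apply: contra_not IH; apply: acl_subset => x [?|/IE[?|->]].
    - by apply: acl_sub; left.
    - by apply: acl_sub; right.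
    - have := acl_transfer (fun x Dx => or_intror Dx) il uv algi.
      by apply: acl_mono; apply: setSU => z Dz; left; right.
  move=> aclw; apply: (unalg i il nalgi).
  have /(_ (F `|` D' `|` Y `|` u @` `I_i) (u i) w) h := exch.
  have : acl ((F `|` D' `|` Y `|` u @` `I_i) `|` [set u i]) w.
    by apply: acl_mono aclw => x [?|/IE[?|->]]; [left; left|left; right|right].
  move=> /h /(_ IH); apply: acl_mono => x [[[[Fx|Dx]|Yx]|ux]|->].
  + by left; left; left; exact: FU.
  + by left; left; right.
  + by left; right.
  + by right.
  + by left; left; left.
Qed.

End Multiplication.

(** * Generic points and grids *)

Section GenericPoint.
Variables (L : language) (N : structure L) (kappa : Type).
Hypothesis N_saturated : saturated N kappa.
Hypothesis finite_small : forall A : set N, finite_set A -> small kappa A.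
Hypothesis exch : acl_exchange N.
Hypothesis wlm : forall A B : set N, small kappa A -> small kappa B ->
  exists C : set N, [/\ small kappa C, indep C set0 (A `|` B)
    & indep A (acl (A `|` C) `&` acl (B `|` C)) B].
Variables (r : nat) (d : 'I_r -> nat) (e : nat).
Variables (phi : formula L ({i : 'I_r & 'I_(d i)} + 'I_e)) (b : 'I_e -> N).

Definition generic (a : Defs.point N d) := forall i,
  ~ (range (a i) `<=` acl (range b `|` \bigcup_(j in [set j | j <> i]) range (a j))).

(** The set for [multiply_tuple] treats all choices in the other blocks at once, so that each copy
    of the block [i0] completes each choice to an edge. *)
Lemma definable_substitution (k : nat) (i0 : 'I_r) (A : set N)
    (c : forall i, 'I_k -> 'I_(d i) -> N) :
  range b `<=` A -> (forall j l, j <> i0 -> range (c j l) `<=` A) ->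
  definable_over A [set x : 'I_(d i0) -> N | forall h : {ffun 'I_r -> 'I_k},
    fiber phi b (dfwith (fun i => c i (h i)) x)].
Proof.
move=> bA cA.
have /choice[g gP] : forall h : {ffun 'I_r -> 'I_k},
    exists g : {i : 'I_r & 'I_(d i)} + 'I_e -> 'I_(d i0) + {y | A y},
      forall x : 'I_(d i0) -> N, join x sval \o g =
        join (fun ij => dfwith (fun i => c i (h i)) x (tag ij) (tagged ij)) b.
  move=> h; have /choice[g gP] : forall s : {i : 'I_r & 'I_(d i)} + 'I_e, exists s' : 'I_(d i0) + {y | A y},
      forall x : 'I_(d i0) -> N, join x sval s' =
        join (fun ij => dfwith (fun i => c i (h i)) x (tag ij) (tagged ij)) b s.
    case=> [[i t]|j] /=; last first.
      by exists (inr (exist _ (b j) (bA _ (imageP _ I)))).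
    have [ii0|ii0] := pselect (i = i0).
      by subst i; exists (inl t) => x; rewrite dfwith_in.
    have cit : A (c i (h i) t) by apply: (cA i (h i)) => //; exists t.
    exists (inr (exist _ _ cit)) => x; rewrite dfwith_out //; apply/eqP => ?; exact: ii0.
  by exists g => x; apply/funext => s; exact: gP.
have [theta thetaP] := definable_forall_fin (fun h => definable_comp (g h) (definable_sat phi)).
exists theta; apply/seteqP; split=> x /=.
  by move=> xP; apply/thetaP => h; rewrite gP; exact: xP.
by move=> /thetaP xP h; have := xP h; rewrite gP.
Qed.

(** The induction keeps each untreated block constant and non-algebraic over [b] and all copies of
    the other blocks. With [k.+1] copies the index [ord0] exists, so such a constant family does
    contain [a i]. *)
Lemma grid_of_generic (a : Defs.point N d) (k : nat) : fiber phi b a -> generic a ->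
  exists c : forall i, 'I_k.+1 -> 'I_(d i) -> N, (forall i, injective (c i)) /\
    forall h : 'I_r -> 'I_k.+1, fiber phi b (fun i => c i (h i)).
Proof.
move=> Ea gen_a.
suff [c [c1 c2 _]] : exists c : forall i, 'I_k.+1 -> 'I_(d i) -> N, [/\
    forall h : 'I_r -> 'I_k.+1, fiber phi b (fun i => c i (h i)),
    forall i, i \in enum 'I_r -> injective (c i) &
    forall i, i \notin enum 'I_r -> (forall l, c i l = a i) /\
      ~ (range (a i) `<=` acl (range b `|` \bigcup_(j in [set j | j <> i])
          \bigcup_l range (c j l)))].
  by exists c; split=> // i; apply: c2; rewrite mem_enum.
elim: (enum 'I_r) => [|i0 s [c [c1 c2 c3]]].
  exists (fun i _ => a i); split=> // i _; split=> // h; apply: (gen_a i).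
  apply: subset_trans h _; apply: acl_mono; apply: setUS => _ [j ji [_ _ [t _ <-]]].
  by exists j => //; exists t.
have [si0|nsi0] := boolP (i0 \in s).
  exists c; split=> [//|i|i]; rewrite inE; first by case/predU1P=> [->|]; exact: c2.
  by rewrite negb_or => /andP[_]; exact: c3.
pose P := range b `|` \bigcup_(j in [set j | j \in s]) \bigcup_l range (c j l).
pose U := \bigcup_(j in [set j | j \notin s /\ j <> i0]) range (a j).
have fU : finite_set U.
  by apply: bigcup_finite => [|j _]; [exact: finite_finset|exact: finite_range].
have fP : finite_set P.
  rewrite finite_setU; split; first exact: finite_range.
  apply: bigcup_finite => [|j _]; first exact: finite_finset.
  by apply: finite_bigcup_fin => l; exact: finite_range.
pose X := [set x : 'I_(d i0) -> N | forall h : {ffun 'I_r -> 'I_k.+1},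
    fiber phi b (dfwith (fun i => c i (h i)) x)].
have defX : definable_over (U `|` P) X.
  apply: definable_substitution => [x bx|j l ji0 _ [t _ <-]]; first by right; left.
  have [js|js] := boolP (j \in s); first by right; right; exists j => //; exists l => //; exists t.
  by left; exists j => //; exists t => //; rewrite (c3 j js).1.
have dfE (h : 'I_r -> 'I_k.+1) (x : 'I_k.+1 -> 'I_(d i0) -> N) :
    dfwith (fun i => c i (h i)) (x (h i0)) = (fun i => dfwith c x i (h i)).
  apply: functional_extensionality_dep => i; have [<-|ii0] := eqVneq i0 i.
    by rewrite !dfwith_in.
  by rewrite !dfwith_out // eq_sym.
have Xa : X (a i0).
  move=> h /=; have -> : dfwith (fun i => c i (h i)) (a i0) = (fun i => c i (h i)); last exact: c1.
  apply: functional_extensionality_dep => i; have [<-|ii0] := eqVneq i0 i.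
    by rewrite dfwith_in (c3 i0 nsi0).1.
  by rewrite dfwith_out // eq_sym.
have nalg : ~ (range (a i0) `<=` acl (U `|` P)).
  move=> h; apply: (c3 i0 nsi0).2; apply: subset_trans h _; apply: acl_mono.
  move=> x [[j [js ji0] [t _ <-]]|[bx|[j js [l _ cx]]]]; [|by left|].
    by right; exists j => //; exists ord0 => //; exists t => //; rewrite (c3 j js).1.
  right; exists j => [ji0|]; last by exists l.
  by move: js; rewrite ji0 /= (negPf nsi0).
have [V [injV XV VP]] := multiply_tuple N_saturated finite_small exch wlm k.+1 fU fP defX Xa nalg.
exists (dfwith c V); split.
- move=> h; rewrite -dfE; have := XV (h i0) [ffun i => h i].
  have -> // : (fun i => c i ([ffun i => h i] i)) = (fun i => c i (h i)).
  by apply: functional_extensionality_dep => i; rewrite ffunE.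
- move=> i; rewrite inE; have [<-|ii0] := eqVneq i0 i.
    by rewrite dfwith_in.
  by rewrite dfwith_out //=; exact: c2.
- move=> i; rewrite inE negb_or => /andP[ii0 nsi].
  rewrite dfwith_out 1?eq_sym //; split; first exact: (c3 i nsi).1.
  (* The last property of [V], applied with [F] the other untreated blocks, shows that a coordinate
     [w] non-algebraic before the replacement of the block [i0] stays so. *)
  move=> alg; apply: (c3 i nsi).2 => w aw; apply: contrapT => nw.
  pose F := \bigcup_(j in [set j | [/\ j \notin s, j <> i0 & j <> i]]) range (a j).
  have FU : F `<=` U by move=> x [j [js ji0 _] ajx]; exists j.
  have Uw : U w by exists i => //; split=> //; exact/eqP.
  apply: (VP F w FU Uw).
    apply: contra_not nw; apply: acl_mono => x [[[j [js _ ji] [t _ <-]]|[bx|[j js [l _ cx]]]]|[t _ <-]].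
    + by right; exists j => //; exists ord0 => //; exists t => //; rewrite (c3 j js).1.
    + by left.
    + right; exists j => [ji|]; last by exists l.
      by move: js; rewrite ji /= (negPf nsi).
    + right; exists i0; first by move=> i0i; move: ii0; rewrite i0i eqxx.
      by exists ord0 => //; exists t => //; rewrite (c3 i0 nsi0).1.
  apply: acl_mono (alg w aw) => x [bx|[j ji [l _]]]; first by left; right; left.
  have [<-|ji0] := eqVneq i0 j; first by rewrite dfwith_in => vx; right; exists l.
  rewrite dfwith_out // => cx; have [js|js] := boolP (j \in s).
    by left; right; right; exists j => //; exists l.
  left; left; exists j; last by rewrite -((c3 j js).1 l).
  by split=> //; apply/eqP; rewrite eq_sym.
Qed.

End GenericPoint.

(** * Iterated derivatives of a definable set *)

Lemma uniform_elimination (L : language) (T : set (sentence L)) (V : finType)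
    (P : forall M : structure L, (option V -> M) -> Prop) :
  eliminates_exists_infty T -> definable P ->
  exists k, forall M : structure L, models M T -> forall v : V -> M,
    `I_k.+1 #<= [set x | P M (oapp v x)] -> infinite_set [set x | P M (oapp v x)].
Proof.
move=> elimT [phi phiP].
have [k kP] := elimT _ (frename (omap (@enum_rank V)) phi).
exists k => M MT v; have := kP M MT (v \o enum_val).
rewrite /= (_ : [set x | sat _ _] = [set x | P M (oapp v x)]) //.
have hE x : oapp (v \o enum_val) x \o omap (@enum_rank V) = oapp v x.
  by apply/funext => -[y|] //=; rewrite enum_rankK.
by apply/seteqP; split=> x /=; rewrite sat_frename hE => /phiP.
Qed.

Section Derivative.
Variables (L : language) (T : set (sentence L)).
Hypothesis T_elim : eliminates_exists_infty T.
Variables (r : nat) (d : 'I_r -> nat) (e : nat).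
Notation coord := {i : 'I_r & 'I_(d i)}.
Notation family := (forall M : structure L, (coord + 'I_e -> M) -> Prop).
Implicit Types (P : family).

(** A fiber moves a whole block, while elimination of [exists^infty] concerns single variables. A
    set of tuples is infinite exactly when one of its coordinate projections is. *)
Definition fiber_projection P (M : structure L) (v : coord + 'I_e -> M) (s : coord) : set M :=
  [set x | exists a : coord -> M, [/\ forall s', tag s' <> tag s -> a s' = v (inl s'),
     a s = x & P M (join a (v \o inr))]].

Lemma definable_fiber_projection P s : definable P ->
  definable (fun M (w : option (coord + 'I_e) -> M) =>
    fiber_projection P (w \o some) s (w None)).
Proof.
move=> dP.
pose h (z : coord + 'I_e) : coord + option (coord + 'I_e) := match z with
  | inl s' => inl s' | inr j => inr (Some (inr j)) end.
have d1 (s' : coord) : definable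
    (fun (M : structure L) (w : coord + option (coord + 'I_e) -> M) =>
    tag s' <> tag s -> w (inl s') = w (inr (Some (inl s')))).
  apply: definable_imp (definable_eq _ _ _).
  have [ss|ss] := pselect (tag s' <> tag s); last by exists FBot.
  by exists (FImp FBot FBot) => M w; split=> // _ [].
have := definable_ex_tuple (definable_and (definable_forall_fin d1)
  (definable_and (definable_eq L (inl s) (inr None)) (definable_comp h dP))).
apply: definable_ext => M w.
have hE (a : coord -> M) : join a w \o h = join a (w \o some \o inr).
  by apply/funext => -[].
split=> [[a [a1 [a2 a3]]]|[a [a1 a2 a3]]]; exists a.
  by split=> //; rewrite -hE.
by split=> //; split=> //; rewrite hE.
Qed.

Definition bounds P K := forall M : structure L, models M T ->
  forall (v : coord + 'I_e -> M) s, `I_K.+1 #<= fiber_projection P v s ->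
  infinite_set (fiber_projection P v s).

Lemma bounds_exists P : definable P -> exists K, bounds P K.
Proof.
move=> dP.
have /choice[K KP] s := uniform_elimination T_elim (definable_fiber_projection s dP).
exists (\max_s K s) => M MT v s ge.
have fE : fiber_projection P v s = [set x | fiber_projection P (oapp v x \o some) s (oapp v x None)] by [].
rewrite fE; apply: (KP s M MT v); rewrite -fE; apply: card_le_trans ge.
by rewrite card_le_II ltnS; apply: leq_bigmax.
Qed.

(** The choice depends neither on the model nor on the parameters, and the final constant inherits
    this uniformity. *)
Definition fiber_bound P : nat := xget 0%N [set K | bounds P K].

Lemma fiber_boundP P : definable P -> bounds P (fiber_bound P).
Proof. by move=> /bounds_exists; exact: xgetPex. Qed.

(* By the choice of [fiber_bound], the inequality says that the projection to [s] of
   the fiber of [P] in the direction [i] is infinite. *)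
Definition derivative P : family := fun M v => P M v /\
  forall i : 'I_r, exists s : coord, tag s = i /\
    `I_(fiber_bound P).+1 #<= fiber_projection P v s.

Lemma definable_derivative P : definable P -> definable (derivative P).
Proof.
move=> dP; apply: definable_and => //; apply: definable_forall_fin => i.
apply: definable_exists_fin => s; apply: definable_and.
  have [ss|ss] := pselect (tag s = i); last by exists FBot.
  by exists (FImp FBot FBot) => M w; split=> // _ [].
exact: definable_card_ge (definable_fiber_projection s dP).
Qed.

Definition nth_derivative P n : family := iter n derivative P.

Lemma definable_nth_derivative P n : definable P -> definable (nth_derivative P n).
Proof. by move=> dP; elim: n => //= n; exact: definable_derivative. Qed.

Lemma nth_derivative_sub P n (M : structure L) (v : coord + 'I_e -> M) : nth_derivative P n v -> P M v.
Proof. by elim: n => //= n IH [/IH]. Qed.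

Section Model.
Variables (N : structure L) (kappa : Type).
Hypothesis N_model : models N T.
Hypothesis N_saturated : saturated N kappa.
Hypothesis finite_small : forall A : set N, finite_set A -> small kappa A.
Hypothesis exch : acl_exchange N.

(** Saturation realizes [Q] together with all formulas over [A] that have a cofinite solution
    set. *)
Lemma infinite_nonalgebraic (A : set N) (V : Type) (c : V -> N)
    (Q : forall M : structure L, (option V -> M) -> Prop) :
  finite_set A -> (forall v, A (c v)) -> definable Q ->
  infinite_set [set x | Q N (oapp c x)] -> exists2 x, Q N (oapp c x) & ~ acl A x.
Proof.
move=> fA Ac [phi phiP] inf.
pose h v : {y | A y} := exist _ (c v) (Ac v).
have hE x : oapp sval x \o omap h = oapp c x by apply/funext => -[].
pose p := frename (omap h) phi |`
  [set psi : formula L (option {y | A y}) | finite_set [set x | ~ sat psi (oapp sval x)]].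
have [x xP] : exists x, forall psi, p psi -> sat psi (oapp sval x).
  apply: (N_saturated (finite_small fA)) => q fq qp.
  pose q' := q `&` [set psi | finite_set [set x | ~ sat psi (oapp sval x)]].
  have fbad : finite_set (\bigcup_(psi in q') [set x | ~ sat psi (oapp sval x)]).
    by apply: bigcup_finite => [|psi []//]; exact: finite_setIl.
  have /infinite_setN0[x [Qx nbad]] := infinite_setD inf fbad.
  exists x => psi qpsi; case: (qp _ qpsi) => [->|fpsi].
    by rewrite sat_frename hE; apply/phiP.
  by apply: contrapT => npsi; apply: nbad; exists psi.
exists x; first by apply/phiP; rewrite -hE -sat_frename; apply: xP; left.
move=> /acl_elim[theta [thx fth]].
suff : sat (FNot theta) (oapp sval x) by apply.
apply: xP; right => /=; congr finite_set: fth.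
by apply/seteqP; split=> y /= => [?|/contrapT]; [apply|].
Qed.

Variable b : 'I_e -> N.

(* An element [s] of [S] in the block can be traded for a coordinate outside: if all of
   these were algebraic over [S \ s], so would be the block, including [s]. *)
Lemma free_avoiding_block (a : coord -> N) i (S : {set coord}) :
  (forall s, tag s = i -> acl (range b `|` a @` [set s | tag s <> i]) (a s)) ->
  acl_free (range b) a [set` S] ->
  exists S' : {set coord}, [/\ acl_free (range b) a [set` S'], #|S'| = #|S| &
    forall s, s \in S' -> tag s <> i].
Proof.
move=> alg; have [m] := ubnP #|[set s in S | tag s == i]|; elim: m S => // m IH S.
rewrite ltnS => leSm freeS.
have [none|/existsNP[s /not_implyP[sS /contrapT si]]] :=
    pselect (forall s, s \in S -> tag s <> i); first by exists S.
have [s' [s'i nalg]] : exists s', tag s' <> i /\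
    ~ acl (range b `|` a @` ([set` S] `\ s)) (a s').
  apply: contrapT => nex; apply: (freeS s sS).
  apply: acl_subset (alg s si) => x [bx|[s' s'i <-]]; first by apply: acl_sub; left.
  by apply: contrapT => nalg; apply: nex; exists s'.
have s'S : s' \notin S :\ s.
  apply/negP => s'S; apply: nalg; apply: acl_sub; right; exists s' => //.
  by move: s'S; rewrite !inE => /andP[/eqP ? ?].
have [||S' [f1 f2 f3]] := IH (s' |: (S :\ s))%SET; last first.
- exists S'; split=> //; rewrite f2 cardsU1 s'S (cardsD1 s S).
  by rewrite (_ : s \in S).
- have -> : [set` (s' |: (S :\ s))%SET] = s' |` ([set` S] `\ s).
    apply/seteqP; split=> z; rewrite /= !inE.
      by case/orP=> [/eqP->|/andP[/eqP ? ?]]; [left|right].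
    by case=> [->|[zS /eqP zs]]; rewrite ?eqxx ?zs ?zS ?orbT.
  apply: free_add => // z [zS zs] aclz; apply: (freeS z zS).
  apply: acl_mono aclz; apply: setUS => _ [y [[yS ys] yz] <-]; by exists y.
- apply: leq_trans leSm; have sA : s \in [set s in S | tag s == i] by rewrite inE sS si eqxx.
  rewrite [X in (_ < X)%N](cardsD1 s) sA add1n ltnS.
  apply: subset_leq_card; apply/fintype.subsetP => z; rewrite !inE.
  by case/andP=> /orP[/eqP->|/andP[-> ->]] /eqP; rewrite ?si //= => ->; rewrite eqxx.
Qed.

(** Without a generic point, each step spends one derivative and enlarges a free set of coordinates:
    some block is algebraic over the others, the free set is moved out of it, and the infinite fiber
    supplies a new block with a coordinate to add. In the end the set exceeds the number of
    coordinates. *)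
Lemma generic_exists P a : definable P ->
  nth_derivative P #|{: coord}|.+1 (join a b) ->
  exists a' : coord -> N, P N (join a' b) /\
    forall i, exists2 s, tag s = i & ~ acl (range b `|` a' @` [set s | tag s <> i]) (a' s).
Proof.
move=> dP Da; apply: contrapT => ngen.
suff /(_ #|{: coord}|.+1 (leqnn _)) [a' [S [_ _]]] : forall m, (m <= #|{: coord}|.+1)%N ->
    exists a' (S : {set coord}), [/\ nth_derivative P (#|{: coord}|.+1 - m) (join a' b),
      acl_free (range b) a' [set` S] & (m <= #|S|)%N].
  by move=> /leq_trans/(_ (max_card _)); rewrite ltnn.
elim=> [_|m IH mn]; first by exists a, finset.set0; split=> // s; rewrite /= inE.
have {IH}[a1 [S [D1 freeS mS]]] := IH (ltnW mn).
have Pa1 := nth_derivative_sub D1.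
have [i alg] : exists i, forall s, tag s = i ->
    acl (range b `|` a1 @` [set s | tag s <> i]) (a1 s).
  apply: contrapT => nalg; apply: ngen; exists a1; split=> // i.
  apply: contrapT => nex; apply: nalg; exists i => s si.
  by apply: contrapT => ns; apply: nex; exists s.
have [S' [freeS' cardS' S'i]] := free_avoiding_block alg freeS.
move: D1; rewrite subSn // => -[_ /(_ i)[s [si ge]]].
have dD := definable_nth_derivative (#|{: coord}| - m) dP.
have inf := fiber_boundP dD N_model ge.
(* The new coordinate avoids the closure of [b] and all of [a1], in particular of the coordinates
   that [a'] keeps. *)
have fab : finite_set (range b `|` range a1).
  by rewrite finite_setU; split; exact: finite_range.
have [|x [a' [a'1 a'2 a'3]] nalg] := @infinite_nonalgebraic _ _ (join a1 b) _ fab _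
    (definable_fiber_projection s dD) inf.
  by case=> z; [right; exists z|left; exists z].
have a'E z : tag z <> i -> a' z = a1 z by rewrite -si; exact: a'1.
exists a', (s |: S')%SET; split.
- by rewrite subSS; congr (nth_derivative _ _ _): a'3.
- have -> : [set` (s |: S')%SET] = s |` [set` S'].
    apply/seteqP; split=> z; rewrite /= !inE.
      by case/orP=> [/eqP->|]; [left|right].
    by case=> [->|->]; rewrite ?eqxx ?orbT.
  apply: free_add => //.
    move=> z zS'; rewrite a'E; last exact: S'i.
    apply: contra_not (freeS' z zS'); apply: acl_mono; apply: setUS => _ [y yz <-].
    by exists y => //; rewrite a'E //; apply: S'i; case: yz.
  rewrite a'2; apply: contra_not nalg; apply: acl_mono; apply: setUS => _ [y yS' <-].
  by exists y => //; rewrite a'E //; exact: S'i.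
- rewrite cardsU1 cardS'; have -> : s \notin S' by apply/negP => /S'i.
  by rewrite add1n ltnS.
Qed.

End Model.
End Derivative.

(** * Counting edges *)

Lemma card_ffun_box (r p : nat) (D : {set 'I_r}) (n : 'I_r -> nat) :
  (forall i, (n i <= p)%N) ->
  #|[set h : {ffun 'I_r -> 'I_p.+1} |
      [forall i, if i \in D then (h i < n i)%N else h i == ord0]]%SET| =
  (\prod_(i in D) n i)%N.
Proof.
move=> np.
pose F i : pred 'I_p.+1 := fun x => if i \in D then (x < n i)%N else x == ord0.
have -> : #|[set h : {ffun 'I_r -> 'I_p.+1} |
      [forall i, if i \in D then (h i < n i)%N else h i == ord0]]%SET| = #|family F|.
  rewrite cardsE; apply: eq_card => h.
  rewrite [LHS]unfold_in; apply/forallP/familyP => hF i; have := hF i; by rewrite /F unfold_in.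
rewrite card_family foldrE big_map big_enum /= (bigID (mem D)) /=.
rewrite [X in (_ * X)%N]big1 ?muln1 => [|i iD]; last first.
  rewrite (eq_card (B := pred1 ord0)) ?card1 // => x.
  by rewrite -!topredE /= /F (negPf iD).
apply: eq_bigr => i iD; rewrite -[RHS]card_ord.
have ltp (x : 'I_(n i)) : (x < p.+1)%N by rewrite ltnS (leq_trans (ltnW (ltn_ord x))).
rewrite -(@card_imset _ _ (fun x => Ordinal (ltp x))); last first.
  by move=> x y /(congr1 val) /= /val_inj.
apply: eq_card => x; rewrite unfold_in /F iD; apply/idP/imsetP => [xn|[y _ ->]] //=.
by exists (Ordinal xn) => //; exact: val_inj.
Qed.

Lemma card_by_fibers (r p : nat) (n : 'I_r -> nat) (i : 'I_r) (K : nat)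
    (Z : {set {ffun 'I_r -> 'I_p.+1}}) : (forall i, (n i <= p)%N) ->
  (forall h j, h \in Z -> (h j < n j)%N) ->
  (forall h, h \in Z -> (#|[set x | [ffun j => if j == i then x else h j] \in Z]%SET| <= K)%N) ->
  (#|Z| <= K * \prod_(j in [set~ i]%SET) n j)%N.
Proof.
move=> np Zn ZK.
(* Fibers in the direction [i] are labelled by functions with the value [ord0] at [i]; the labels
   lie in a box in the other coordinates. *)
pose rep (h : {ffun 'I_r -> 'I_p.+1}) : {ffun 'I_r -> 'I_p.+1} := [ffun j => if j == i then ord0 else h j].
rewrite -sum1_card (partition_big_imset rep) /=.
apply: (@leq_trans (\sum_(g in rep @: Z) K)%N).
  apply: leq_sum => _ /imsetP[h hZ ->]; rewrite sum1dep_card.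
  apply: leq_trans (ZK h hZ).
  have injf : {in [set h' in Z | rep h' == rep h]%SET &, injective (fun h' : {ffun 'I_r -> 'I_p.+1} => h' i)}.
    move=> h1 h2; rewrite !inE => /andP[_ /eqP/ffunP r1] /andP[_ /eqP/ffunP r2] e.
    apply/ffunP => j; have [->//|ji] := eqVneq j i.
    by have := r1 j; have := r2 j; rewrite !ffunE (negPf ji) => -> ->.
  rewrite -(card_in_imset injf); apply/subset_leq_card/fintype.subsetP => _ /imsetP[h' h'Z ->].
  move: h'Z; rewrite !inE => /andP[h'Z /eqP/ffunP r'].
  rewrite (_ : [ffun j => _] = h') //; apply/ffunP => j; rewrite ffunE.
  by case: eqP => [->//|ji]; have := r' j; rewrite !ffunE; case: eqP.
rewrite sum_nat_const mulnC leq_mul2l; apply/orP; right.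
rewrite -(card_ffun_box _ np); apply/subset_leq_card/fintype.subsetP => _ /imsetP[h hZ ->].
rewrite inE; apply/forallP => j; rewrite !inE ffunE.
by case: eqP => //= _; exact: Zn.
Qed.

(** For positive [r], the subsets with [r.-1] elements are the complements of singletons. *)
Lemma deltaE (r : nat) (n : 'I_r -> nat) : (0 < r)%N ->
  delta n = (\sum_i \prod_(j in [set~ i]%SET) n j)%N.
Proof.
move=> r0; rewrite /delta.
have injC : {in [set: 'I_r]%SET &, injective (fun i : 'I_r => [set~ i]%SET)}.
  by move=> i j _ _ /(congr1 (fun S => ~: S)%SET); rewrite !finset.setCK => /finset.set1_inj.
transitivity (\sum_(S in [set [set~ i] | i in [set: 'I_r]]%SET) \prod_(j in S) n j)%N.
  apply: eq_bigl => S; apply/eqP/imsetP => [cardS|[i _ ->]]; last first.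
    by rewrite cardsC1 card_ord.
  have /cards1P[i iE] : #|~: S|%SET == 1%N.
    by rewrite cardsCs finset.setCK card_ord cardS -subn1 subKn.
  by exists i; rewrite // -iE finset.setCK.
by rewrite big_imset //=; apply: eq_bigl => i; rewrite inE.
Qed.

(** One value more than the bound on [A] keeps the codomain inhabited, so that [f] is total on
    [T]. *)
Lemma card_nleP (T : Type) (A : set T) (k : nat) :
  ~ (`I_k.+1 #<= A) -> exists f : T -> 'I_k.+1, {in A &, injective f}.
Proof.
move=> nk; have [m Am] : exists m, A #= `I_m.
  apply/finite_setP; apply: contrapT => /infiniteP inf; apply: nk.
  exact: card_le_trans (card_leT _) inf.
have mk : (m <= k)%N.
  rewrite leqNgt; apply/negP => km; apply: nk.
  have /card_eqPle[_] := Am; apply: card_le_trans; by rewrite card_le_II.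
have /card_eqPle[/pcard_leP/injfunPex[f fA injf] _] := Am.
exists (fun x => inord (f x)) => x y xA yA /(congr1 (@nat_of_ord _)).
rewrite !inordK; [exact: injf| |].
  by rewrite ltnS; apply: leq_trans mk; apply: ltnW; apply: fA; exact: set_mem.
by rewrite ltnS; apply: leq_trans mk; apply: ltnW; apply: fA; exact: set_mem.
Qed.

(** With [p] bounding all sides, the points of the grid become elements of a finite type, in which
    counting takes place. *)
Lemma grid_code (M : Type) (r : nat) (d : 'I_r -> nat)
    (B : forall i : 'I_r, set ('I_(d i) -> M)) (n : 'I_r -> nat) :
  (forall i, B i #= `I_(n i)) ->
  exists p (code : Defs.point M d -> {ffun 'I_r -> 'I_p.+1}),
  [/\ forall i, (n i <= p)%N,
    forall a a' i, B i (a i) -> B i (a' i) ->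
      (code a i = code a' i <-> a i = a' i),
    forall a i, B i (a i) -> (code a i < n i)%N &
    forall h : {ffun 'I_r -> 'I_p.+1}, (forall i, (h i < n i)%N) ->
      exists2 a, grid B a & code a = h].
Proof.
move=> card_B.
have bij i : {f : ('I_(d i) -> M) -> nat | set_bij (B i) `I_(n i) f}.
  by apply: cid; apply/card_set_bijP.
pose f i := sval (bij i); have fP i : set_bij (B i) `I_(n i) (f i) := svalP (bij i).
pose p := \max_i n i; have np i : (n i <= p)%N by exact: leq_bigmax.
have fp i x : B i x -> (f i x < p.+1)%N.
  by move=> Bx; have [/(_ x Bx)/= fn _ _] := fP i; rewrite ltnS (leq_trans (ltnW fn)).
exists p, (fun a => [ffun i => inord (f i (a i))]); split=> //.
- move=> a a' i Ba Ba'; rewrite !ffunE; split=> [/(congr1 (@nat_of_ord _))|-> //].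
  rewrite !inordK ?fp //; have [_ injf _] := fP i.
  by move=> /injf; apply; rewrite inE.
- move=> a i Ba; rewrite ffunE inordK ?fp //.
  by have [/(_ (a i) Ba)] := fP i.
- move=> h hn.
  have ex i : {x | B i x & f i x = h i}.
    by apply: cid2; have [_ _ /(_ (h i) (hn i))[x Bx fx]] := fP i; exists x.
  exists (fun i => s2val (ex i)); first by move=> i; exact: s2valP.
  apply/ffunP => i; rewrite ffunE; apply: ord_inj.
  by rewrite (s2valP' (ex i)) inordK.
Qed.

Definition codes (M : Type) (r : nat) (d : 'I_r -> nat) (p : nat)
    (code : Defs.point M d -> {ffun 'I_r -> 'I_p.+1}) (E : set (Defs.point M d)) :
    {set {ffun 'I_r -> 'I_p.+1}} :=
  [set h | `[< exists2 a, E a & code a = h >]]%SET.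

Lemma card_codes (M : Type) (r : nat) (d : 'I_r -> nat) (p : nat)
    (code : Defs.point M d -> {ffun 'I_r -> 'I_p.+1}) (E : set (Defs.point M d)) :
  {in E &, injective code} -> E #= `I_#|codes code E|.
Proof.
move=> injc; have := inj_card_eq injc; rewrite card_eq_sym => /card_eq_trans; apply.
have -> : code @` E = [set` codes code E].
  by apply/seteqP; split=> h /=; rewrite inE => /asboolP.
have -> : [set` codes code E] = range (fun j : 'I_#|codes code E| => enum_val j).
  apply/seteqP; split=> [h hE|_ [j _ <-]]; last exact: enum_valP.
  by exists (enum_rank_in hE h) => //; rewrite enum_rankK_in.
have enum_inj : {in [set: 'I_#|codes code E|] &,
    injective (fun j : 'I_#|codes code E| => enum_val j)}.
  by move=> j j' _ _; exact: enum_val_inj.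
apply: card_eq_trans (inj_card_eq enum_inj) _.
by rewrite card_eq_sym; exact: card_II.
Qed.

Lemma card_bigcup_le (I U : finType) (F : I -> {set U}) :
  (#|(\bigcup_i F i)%SET| <= \sum_i #|F i|)%N.
Proof.
elim/big_ind2: _ => [|A a B b Aa Bb|//]; first by rewrite cards0.
by rewrite (leq_trans (leq_card_setU a b).1) // leq_add.
Qed.

Section EdgeBound.
Variables (L : language) (T : set (sentence L)).
Variables (r : nat) (d : 'I_r -> nat) (e : nat).
Notation coord := {i : 'I_r & 'I_(d i)}.
Variable P : forall M : structure L, (coord + 'I_e -> M) -> Prop.

Definition coords (M : Type) (a : Defs.point M d) : coord -> M :=
  fun s => a (tag s) (tagged s).

(** A summand bounds the size of a thin fiber by the possible values of its coordinates; the
    successor comes from [card_nleP]. *)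
Definition edge_constant (N : nat) : nat :=
  (\sum_(l < N) (fiber_bound T (nth_derivative T P l)).+1 ^ \max_i d i)%N.

Variables (M : structure L) (b : 'I_e -> M).

(** The points lost between two successive derivatives because of the direction [i]. *)
Definition thin (l : nat) (i : 'I_r) : set (Defs.point M d) :=
  [set a | nth_derivative T P l (join (coords a) b) /\ forall s, tag s = i ->
    ~ (`I_(fiber_bound T (nth_derivative T P l)).+1 #<=
       fiber_projection (nth_derivative T P l) (join (coords a) b) s)].

Lemma thin_cover (N : nat) (a : Defs.point M d) : P (join (coords a) b) ->
  ~ nth_derivative T P N (join (coords a) b) ->
  exists l : 'I_N, exists i, thin l i a.
Proof.
move=> Pa nDa.
have [l [lN Dl nDl]] : exists l, [/\ (l < N)%N, nth_derivative T P l (join (coords a) b) &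
    ~ nth_derivative T P l.+1 (join (coords a) b)].
  elim: N nDa => [//|N IH] nDa.
  have [DN|/IH[l [lN Dl nDl]]] := pselect (nth_derivative T P N (join (coords a) b)).
    by exists N.
  by exists l; split=> //; exact: ltnW.
exists (Ordinal lN); apply: contrapT => nthin; apply: nDl; split=> // i.
apply: contrapT => nex; apply: nthin; exists i; split=> // s si ge.
by apply: nex; exists s.
Qed.

(** Within its fiber, a thin point is determined by [d i] coordinates, each ranging over a
    projection with at most [fiber_bound] elements. *)
Lemma card_thin (B : forall i : 'I_r, set ('I_(d i) -> M)) (n : 'I_r -> nat) (p : nat)
    (code : Defs.point M d -> {ffun 'I_r -> 'I_p.+1}) (l : nat) (i : 'I_r) :
  (forall i, (n i <= p)%N) ->
  (forall a a' i, B i (a i) -> B i (a' i) ->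
      (code a i = code a' i <-> a i = a' i)) ->
  (forall a i, B i (a i) -> (code a i < n i)%N) ->
  (#|codes code (grid B `&` thin l i)| <=
   (fiber_bound T (nth_derivative T P l)).+1 ^ d i * \prod_(j in [set~ i]%SET) n j)%N.
Proof.
move=> np codeI coden; set K := fiber_bound T _.
apply: card_by_fibers => // h.
  by move=> j; rewrite inE => /asboolP[a [Ba _] <-]; exact: coden.
rewrite inE => /asboolP[a [Ba [Da nge]] ha].
set X := [set x | _]%SET.
pose S (t : 'I_(d i)) := fiber_projection (nth_derivative T P l) (join (coords a) b) (Tagged (fun i => 'I_(d i)) t : coord).
have /choice[f fP] : forall t : 'I_(d i), exists f : M -> 'I_K.+1, {in S t &, injective f}.
  by move=> t; apply: card_nleP; exact: nge.
have /choice[g gP] : forall x : 'I_p.+1, exists a' : Defs.point M d,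
    x \in X -> [/\ grid B a', thin l i a' &
      code a' = [ffun j => if j == i then x else h j]].
  move=> x; have [xX|nxX] := boolP (x \in X); last by exists a.
  move: xX; rewrite /X inE inE => /asboolP[a' [Ba' ta'] ca']; by exists a'.
(* The codes agree off [i], so [g x] lies in the same fiber as [a]. *)
have gS x t : x \in X -> S t (g x i t).
  move=> /gP[Bg [Dg _] cg]; exists (coords (g x)); split=> //.
  move=> s' s'i; rewrite /= /coords (_ : g x (tag s') = a (tag s')) //.
  by apply/codeI => //; rewrite cg ffunE -ha; case: eqP s'i.
rewrite -[K.+1](card_ord K.+1) -[d i](card_ord (d i)) -card_ffun.
pose F x : {ffun 'I_(d i) -> 'I_K.+1} := [ffun t => f t (g x i t)].
have injF : {in X &, injective F}.
  move=> x x' xX x'X /ffunP FE.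
  have gE : g x i = g x' i.
    apply/funext => t; apply: (fP t); rewrite ?inE; [exact: gS|exact: gS|].
    by have := FE t; rewrite !ffunE.
  have [Bg _ /ffunP/(_ i)] := gP x xX; have [Bg' _ /ffunP/(_ i)] := gP x' x'X.
  by rewrite !ffunE eqxx => <- <-; apply/codeI.
rewrite -(card_in_imset injF); exact: max_card.
Qed.

Lemma edge_bound (N : nat) (B : forall i : 'I_r, set ('I_(d i) -> M)) (n : 'I_r -> nat)
    (E : set (Defs.point M d)) (m : nat) :
  (0 < r)%N -> (forall a, E a -> P (join (coords a) b)) ->
  (forall a, E a -> ~ nth_derivative T P N (join (coords a) b)) ->
  (forall i, B i #= `I_(n i)) -> E `&` grid B #= `I_m ->
  (m <= edge_constant N * delta n)%N.
Proof.
move=> r0 EP END card_B card_E.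
have [p [code [np codeI coden _]]] := grid_code card_B.
have injc : {in E `&` grid B &, injective code}.
  move=> a a'; rewrite !inE => -[_ Ba] [_ Ba'] /ffunP caa'.
  by apply: functional_extensionality_dep => i; apply/codeI.
have -> : m = #|codes code (E `&` grid B)|.
  apply/card_eq_II; rewrite card_eq_sym; apply: card_eq_trans card_E.
  by rewrite card_eq_sym; exact: card_codes.
have sub : codes code (E `&` grid B) \subset
    (\bigcup_(l < N) \bigcup_(i < r) codes code (grid B `&` thin l i))%SET.
  apply/fintype.subsetP => h; rewrite inE => /asboolP[a [Ea Ba] ca].
  have [l [i tla]] := thin_cover (EP a Ea) (END a Ea).
  apply/finset.bigcupP; exists l => //; apply/finset.bigcupP; exists i => //.
  by rewrite inE; apply/asboolP; exists a.
apply: leq_trans (subset_leq_card sub) _.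
rewrite /edge_constant big_distrl /=.
apply: leq_trans (card_bigcup_le _) _; apply: leq_sum => l _.
apply: leq_trans (card_bigcup_le _) _; rewrite deltaE // big_distrr /=.
apply: leq_sum => i _; apply: leq_trans (card_thin l i np codeI coden) _.
by rewrite leq_mul2r; apply/orP; right; rewrite leq_pexp2l // leq_bigmax.
Qed.

End EdgeBound.

(** * Transfer from a saturated model and the dichotomy *)

Import GRing.Theory Num.Theory.
Local Open Scope ring_scope.

Section Uniformity.
Variables (L : language) (T : set (sentence L)).
Hypotheses (T_geometric : geometric T) (T_wlm : weakly_locally_modular T).
Variables (r : nat) (d : 'I_r -> nat) (e : nat).
Notation coord := {i : 'I_r & 'I_(d i)}.
Variable phi : formula L (coord + 'I_e).
Notation P := (fun (M : structure L) (v : coord + 'I_e -> M) => sat phi v).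

(** Presenting the grid by finitely many elements of [M] makes its existence a first-order condition
    on [b]. *)
Definition has_grid (k : nat) (M : structure L) (b : 'I_e -> M) :=
  exists c : coord * 'I_k -> M,
    (forall i (l l' : 'I_k), l <> l' -> exists t : 'I_(d i),
       c (existT _ i t, l) <> c (existT _ i t, l')) /\
    forall h : {ffun 'I_r -> 'I_k}, sat phi (join (fun s => c (s, h (tag s))) b).

Lemma definable_has_grid k :
  definable (fun (M : structure L) (b : 'I_e -> M) => has_grid k b).
Proof.
apply: (definable_ex_tuple (P := fun M (v : coord * 'I_k + 'I_e -> M) =>
  (forall i (l l' : 'I_k), l <> l' -> exists t : 'I_(d i),
       v (inl (existT _ i t, l)) <> v (inl (existT _ i t, l'))) /\
  forall h : {ffun 'I_r -> 'I_k}, sat phi (join (fun s => v (inl (s, h (tag s)))) (v \o inr)))).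
apply: definable_and.
  apply: definable_forall_fin => i; apply: definable_forall_fin => l.
  apply: definable_forall_fin => l'; apply: definable_imp.
    have [ll|ll] := pselect (l <> l'); last by exists FBot.
    by exists (FImp FBot FBot) => M w; split=> // _ [].
  by apply: definable_exists_fin => t; apply/definable_not/definable_eq.
apply: definable_forall_fin => h.
pose g (s : coord + 'I_e) : coord * 'I_k + 'I_e :=
  match s with inl s => inl (s, h (tag s)) | inr j => inr j end.
apply: definable_ext (definable_comp g (definable_sat phi)) => M v.
by rewrite (_ : v \o g = join (fun s => v (inl (s, h (tag s)))) (v \o inr)) //;
  apply/funext => -[].
Qed.

Lemma K_free_has_grid k (M : structure L) (b : 'I_e -> M) :
  has_grid k b -> ~ K_free k (fiber phi b).
Proof.
move=> [c [cinj cP]]; apply.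
pose C i := range (fun (l : 'I_k) (t : 'I_(d i)) => c (existT _ i t, l)).
exists C; split=> [i|a Ca].
  have injc : {in [set: 'I_k] &,
      injective (fun (l : 'I_k) (t : 'I_(d i)) => c (existT _ i t, l))}.
    move=> l l' _ _ cll'; apply: contrapT => /(cinj i)[t]; apply.
    exact: (congr1 (@^~ t) cll').
  apply: card_eq_trans (inj_card_eq injc) _.
  by rewrite card_eq_sym; exact: card_II.
have /choice[h hP] : forall i, exists l : 'I_k, (fun t => c (existT _ i t, l)) = a i.
  by move=> i; have [l _ ?] := Ca i; exists l.
have := cP [ffun i => h i]; rewrite /fiber /=; congr (sat phi (join _ _)).
by apply/funext => -[i t]; rewrite ffunE /= -hP.
Qed.

(** That some parameters admit a point in the derivative but no grid is a single sentence. It passes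
    to a saturated model, where a generic point yields the grid. *)
Lemma derivative_of_K_free k (M : structure L) (b : 'I_e -> M) (a : coord -> M) :
  (0 < r)%N -> models M T -> K_free k (fiber phi b) ->
  ~ nth_derivative T P #|{: coord}|.+1 (join a b).
Proof.
(* For [k = 0] freeness fails: the sides are empty and, as [r] is positive, so is the grid. *)
move=> r0 MT; case: k => [|k] Kfree Dab.
  apply: Kfree; exists (fun _ => set0); split=> [i|x /(_ (Ordinal r0)) []].
  by rewrite II0 card_eq00.
have elimT := T_geometric.2.
have dP := definable_sat phi.
have dD := definable_and (definable_nth_derivative T #|{: coord}|.+1 dP)
  (definable_comp inr (definable_not (definable_has_grid k.+1))).
pose g (s : coord + 'I_e) : (coord + 'I_e) + void := inl s.
have [sigma sigmaP] := definable_ex_tuple (definable_comp g dD).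
have [kappa [N [kappa_large Nsat Nsmall NM]]] :=
  saturated_equivalent M (Defs.fsym L + rsym L + nat)%type.
have NT : models N T by move=> tau Ttau; apply/NM; exact: MT.
have Nexch := T_geometric.1 N NT.
have : sat sigma (of_void M).
  apply/sigmaP; exists (join a b); split; first exact: Dab.
  by move=> /K_free_has_grid.
move=> /NM/sigmaP[z [Dz ngrid]]; apply: ngrid.
rewrite (_ : join z _ \o g = join (z \o inl) (z \o inr)) in Dz; last first.
  by apply/funext => -[].
have [a' [Pa' gen_a']] := generic_exists elimT NT Nsat Nsmall Nexch dP Dz.
have Nwlm := T_wlm kappa_large NT Nsat.
have gen : generic (z \o inr) (fun i (t : 'I_(d i)) => a' (existT _ i t)).
  move=> i sub; have [[j t] /= ji] := gen_a' i; rewrite {}ji in t *.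
  apply; have := sub (a' (existT _ i t)) (ex_intro2 _ _ t I erefl).
  apply: acl_mono; apply: setUS => _ [j' jj' [u _ <-]].
  by exists (existT _ j' u).
have Ea : fiber phi (z \o inr) (fun i (t : 'I_(d i)) => a' (existT _ i t)).
  rewrite /fiber /= (_ : (fun ij => _) = a') //.
  by apply/funext => -[].
have [c [injc cP]] := grid_of_generic Nsat Nsmall Nexch Nwlm k Ea gen.
exists (fun s => c (tag s.1) s.2 (tagged s.1)); split.
  move=> i l l' ll'; apply: contrapT => same; apply: ll'; apply: (injc i).
  apply/funext => t; apply: contrapT => ct; apply: same; by exists t.
by move=> h; have := cP h; congr (sat phi (join _ _)).
Qed.

End Uniformity.

Lemma full_grid_edges (M : Type) (r : nat) (d : 'I_r -> nat) (k : nat)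
    (C : forall i : 'I_r, set ('I_(d i) -> M)) (E : set (Defs.point M d)) :
  (forall i, C i #= `I_k) -> grid C `<=` E ->
  exists2 m, (k ^ r <= m)%N & E `&` grid C #= `I_m.
Proof.
move=> cardC CE; have [p [code [np codeI _ codeS]]] := grid_code cardC.
have injc : {in E `&` grid C &, injective code}.
  move=> a a'; rewrite !inE => -[_ Ca] [_ Ca'] /ffunP caa'.
  by apply: functional_extensionality_dep => i; apply/codeI.
exists #|codes code (E `&` grid C)|; last exact: card_codes.
have := card_ffun_box [set: 'I_r]%SET np.
rewrite prod_nat_const cardsT card_ord => <-; apply/subset_leq_card/fintype.subsetP => h.
rewrite !inE => /forallP hk.
have [|a Ca ca] := codeS h; first by move=> i; have := hk i; rewrite inE.
by apply/asboolP/asboolP; exists a => //; split=> //; exact: CE.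
Qed.

Theorem theorem5p6 (R : realType) (L : language) (T : set (sentence L))
    (T_complete : complete_theory T) (T_geometric : geometric T)
    (T_wlm : weakly_locally_modular T)
    (r : nat) (r_ge2 : (2 <= r)%N) (d : 'I_r -> nat) (e : nat)
    (phi : formula L ({i : 'I_r & 'I_(d i)} + 'I_e)) :
  exists alpha : R, 0 < alpha /\
  forall M : structure L, models M T ->
  forall b : 'I_e -> M,
  exactly_one
    (forall k : nat, ~ K_free k (fiber phi b))
    (forall (B : forall i : 'I_r, set ('I_(d i) -> M)) (n : 'I_r -> nat),
       (forall i, B i #= `I_(n i)) ->
     forall m : nat, fiber phi b `&` grid B #= `I_m ->
       m%:R <= alpha * (delta n)%:R).
Proof.
have r0 : (0 < r)%N by exact: ltnW.
pose N := #|{: {i : 'I_r & 'I_(d i)}}|.+1.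
(* The successor makes the constant positive. *)
pose A := (edge_constant T (fun (M : structure L)
  (v : {i : 'I_r & 'I_(d i)} + 'I_e -> M) => sat phi v) N).+1.
exists A%:R; split=> [|M MT b]; first by rewrite ltr0n.
have [all_k|/existsNP[k /contrapT kfree]] := pselect (forall k, ~ K_free k (fiber phi b)).
  (* With all sides of size [k], the bound would give [k ^ r <= A * r * k ^ r.-1], that is
     [k <= A * r]. *)
  left; split=> // bound; pose k := (A * r).+1.
  have /contrapT[C [cardC CE]] := all_k k.
  have [m km Em] := full_grid_edges cardC CE.
  have := bound C (fun=> k) cardC m Em; rewrite -natrM ler_nat => mA.
  have := leq_trans km mA; rewrite deltaE //.
  rewrite (eq_bigr (fun=> k ^ r.-1)%N) => [|i _]; last first.
    by rewrite prod_nat_const cardsC1 card_ord.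
  rewrite sum_nat_const card_ord mulnA -[X in (k ^ X <= _)%N](prednK r0) expnS.
  by rewrite leq_pmul2r ?expn_gt0 // ltnn.
right; split=> [/(_ k)//|B n cardB m cardE]; rewrite -natrM ler_nat.
have noD a : fiber phi b a -> ~ nth_derivative T _ N (join (coords a) b) :=
  fun _ => derivative_of_K_free T_geometric T_wlm r0 MT kfree.
apply: leq_trans (edge_bound _ _ noD cardB cardE) _ => //.
by rewrite leq_mul2r leqnSn orbT.
Qed.
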